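(* Let $N\ge2$ and let $\Omega\subsetneq\mathbb{R}^N$ be a domain. Let $1<p<\infty$ and $\lambda\in\mathbb{R}$ satisfy $p+\lambda-1\ne0$. Then, for $u\in C_0^\infty(\Omega)$, $$\int_\Omega\frac{|\nabla u|^p}{d_\Omega^\lambda}dx-\left|\frac{p+\lambda-1}{p}\right|^p\int_\Omega\frac{|u|^p}{d_\Omega^{\lambda+p}}dx=\int_\Omega\frac1{d_\Omega^\lambda}\,C_p\!\left(\nabla u,\ d_\Omega^{\frac{p+\lambda-1}{p}}\nabla\!\left(d_\Omega^{-\frac{p+\lambda-1}{p}}u\right)\right)dx-\frac{p+\lambda-1}{p}\left|\frac{p+\lambda-1}{p}\right|^{p-2}\left\langle\Delta d_\Omega,\ |u|^pd_\Omega^{1-p-\lambda}\right\rangle .$$ Moreover, when $-(p+\lambda-1)\Delta d_\Omega\ge0$ in the sense of distributions, the right-hand side is nonnegative, so this identity is an improvement of $$\int_\Omega\frac{|\nabla u|^p}{d_\Omega^\lambda}dx\ge\left|\frac{p+\lambda-1}{p}\right|^p\int_\Omega\frac{|u|^p}{d_\Omega^{\lambda+p}}dx .$$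
   Context: $d_\Omega(x)=\operatorname{dist}(x,\partial\Omega)$. For $x,y\in\mathbb{R}^N$, $C_p(x,y)=|x|^p-|x-y|^p-p|x-y|^{p-2}(x-y)\cdot y$. $\Delta d_\Omega$ is the distributional Laplacian: $\langle\Delta d_\Omega,\psi\rangle=\int_\Omega d_\Omega\Delta\psi\,dx=-\int_\Omega\nabla d_\Omega\cdot\nabla\psi\,dx$ for $\psi\in C_0^\infty(\Omega)$; since $d_\Omega$ is Lipschitz, the last expression defines the pairing for compactly supported Lipschitz $\psi$. *)

(* Defs.v *)
From HB Require Import structures.
From mathcomp Require Import all_boot all_order all_algebra.
From mathcomp Require Import all_classical all_reals all_analysis.
Set Implicit Arguments.
Unset Strict Implicit.
Unset Printing Implicit Defensive.
Import Order.TTheory GRing.Theory Num.Theory.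
Import numFieldNormedType.Exports.
Local Open Scope classical_set_scope.
Local Open Scope ring_scope.

(* The product sigma-algebra of the Borel sigma-algebra of R on 'rV[R]_n,
   i.e. the one generated by the coordinate functions, as the library does
   for n.-tuple T. *)
Definition measure_rV_display : measure_display. Proof. by constructor. Qed.

Section measurable_rV.
Context {R : realType} (n : nat).

Definition rV_coord (i : 'I_n) (x : 'rV[R]_n) : measurableTypeR R := x 0 i.

Let rV_set0 : g_sigma_preimage rV_coord set0.
Proof. exact: sigma_algebra0. Qed.

Let rV_setC A : g_sigma_preimage rV_coord A -> g_sigma_preimage rV_coord (~` A).
Proof. exact: sigma_algebraC. Qed.

Let rV_bigcup (F : (set 'rV[R]_n)^nat) :
  (forall i, g_sigma_preimage rV_coord (F i)) ->
  g_sigma_preimage rV_coord (\bigcup_i (F i)).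
Proof. exact: sigma_algebra_bigcup. Qed.

HB.instance Definition _ := @isMeasurable.Build measure_rV_display
  'rV[R]_n (g_sigma_preimage rV_coord) rV_set0 rV_setC rV_bigcup.

End measurable_rV.

Section measurable_fun_rV.
Context {R : realType}.

Lemma measurable_rV_coord n (i : 'I_n) :
  measurable_fun [set: 'rV[R]_n] (@rV_coord R n i).
Proof.
move=> _ Y mY; rewrite setTI; apply: sub_sigma_algebra => /=.
rewrite -bigcup_seq/=; exists i => /=; first by rewrite mem_index_enum.
by exists Y => //; rewrite setTI.
Qed.

Lemma measurable_fun_rVP d (T : measurableType d) n (f : T -> 'rV[R]_n) :
  (forall i, measurable_fun [set: T] (@rV_coord R n i \o f)) ->
  measurable_fun [set: T] f.
Proof.
move=> mf _ A mA; rewrite setTI.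
suff : @measurable _ 'rV[R]_n `<=` [set A | measurable (f @^-1` A)] by exact.
apply: smallest_sub.
  split=> /=; first by rewrite preimage_set0.
  - by move=> B mB; rewrite setTD preimage_setC; exact: measurableC.
  - by move=> F mF; rewrite preimage_bigcup; exact: bigcupT_measurable.
move=> B; rewrite -bigcup_seq => -[i _ [C mC <-]] /=.
by rewrite setTI -comp_preimage -[X in measurable X]setTI; exact: mf.
Qed.

Definition rV_cons n (z : measurableTypeR R * 'rV[R]_n) : 'rV[R]_n.+1 :=
  row_mx (z.1%:M : 'rV_1) z.2.

Definition rV_uncons n (x : 'rV[R]_n.+1) : measurableTypeR R * 'rV[R]_n :=
  (x 0 0, rsubmx (x : 'rV_(1 + n))).

Lemma rV_consK n : cancel (@rV_cons n) (@rV_uncons n).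
Proof.
move=> [a x]; rewrite /rV_uncons /rV_cons row_mxKr; congr pair.
rewrite -[RHS](_ : (a%:M : 'rV_1) 0 0 = a); last by rewrite mxE eqxx mulr1n.
rewrite -(row_mxEl (a%:M : 'rV_1) x 0 0); congr (row_mx _ _ _ _).
exact/val_inj.
Qed.

Lemma rV_consE0 n z : @rV_cons n z 0 0 = z.1.
Proof. by have /(congr1 fst) := rV_consK z. Qed.

Lemma rV_consES n z (i : 'I_n) : rV_cons z 0 (lift ord0 i) = z.2 0 i.
Proof.
rewrite -(row_mxEr (z.1%:M : 'rV_1) z.2 0 i); congr (row_mx _ _ _ _).
exact/val_inj.
Qed.

Lemma measurable_rV_cons n : measurable_fun setT (@rV_cons n).
Proof.
apply: measurable_fun_rVP => i.
case: (unliftP ord0 i) => [j|] ->.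
- rewrite (_ : _ \o _ = @rV_coord R n j \o snd).
    exact: measurableT_comp (measurable_rV_coord j) measurable_snd.
  by apply/funext => z; rewrite /= /rV_coord rV_consES.
- rewrite (_ : _ \o _ = fst); first exact: measurable_fst.
  by apply/funext => z; rewrite /= /rV_coord rV_consE0.
Qed.

Lemma measurable_rV_uncons n : measurable_fun setT (@rV_uncons n).
Proof.
apply/measurable_fun_pair; first exact: (measurable_rV_coord ord0).
apply: measurable_fun_rVP => i.
rewrite (_ : _ \o _ = @rV_coord R n.+1 (rshift 1 i)).
  exact: measurable_rV_coord.
by apply/funext => x; rewrite /= /rV_coord mxE.
Qed.

End measurable_fun_rV.

Section lebesgue_rV.
Context {R : realType}.
Local Open Scope ereal_scope.

Section step.
Context n (m : {sigma_finite_measure set 'rV[R]_n -> \bar R}).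

Definition lebesgue_rV_step : set 'rV[R]_n.+1 -> \bar R :=
  pushforward (@lebesgue_measure R \x m) (@rV_cons R n).

Let measurable_cons_preimage A :
  measurable A -> measurable (@rV_cons R n @^-1` A).
Proof.
by move=> mA; rewrite -[X in measurable X]setTI; exact: measurable_rV_cons.
Qed.

Let step0 : lebesgue_rV_step set0 = 0.
Proof. by rewrite /lebesgue_rV_step /pushforward preimage_set0 measure0. Qed.

Let step_ge0 A : 0 <= lebesgue_rV_step A.
Proof. exact: (measure_ge0 (@lebesgue_measure R \x m)). Qed.

Let step_sigma_additive : semi_sigma_additive lebesgue_rV_step.
Proof.
move=> F mF tF mUF; rewrite /lebesgue_rV_step /pushforward preimage_bigcup.
apply: measure_semi_sigma_additive.
- by move=> i; exact: measurable_cons_preimage.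
- apply/trivIsetP => /= i j _ _ ij; rewrite -preimage_setI.
  by move/trivIsetP : tF => /(_ _ _ _ _ ij) ->//; rewrite preimage_set0.
- by rewrite -preimage_bigcup; exact: measurable_cons_preimage.
Qed.

HB.instance Definition _ := isMeasure.Build _ _ _ lebesgue_rV_step
  step0 step_ge0 step_sigma_additive.

Let step_sigma_finite : sigma_finite setT lebesgue_rV_step.
Proof.
have /sigma_finiteP[F [TF ndF Foo]] := sigma_finiteT (@lebesgue_measure R).
have /sigma_finiteP[G [TG ndG Goo]] := sigma_finiteT m.
exists (fun k => @rV_uncons R n @^-1` (F k `*` G k)).
  rewrite -preimage_bigcup; apply/esym; rewrite -subTset => x _ /=.
  have [i _ Fi] : (\bigcup_k F k) (rV_uncons x).1 by rewrite -TF.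
  have [j _ Gj] : (\bigcup_k G k) (rV_uncons x).2 by rewrite -TG.
  exists (maxn i j) => //; split.
  - by apply: (subsetPset _ _ (ndF _ _ (leq_maxl i j))).
  - by apply: (subsetPset _ _ (ndG _ _ (leq_maxr i j))).
move=> k; have [mF Fk] := Foo k; have [mG Gk] := Goo k; split.
  rewrite -[X in measurable X]setTI; apply: measurable_rV_uncons => //.
  exact: measurableX.
rewrite /lebesgue_rV_step /pushforward -comp_preimage.
rewrite (_ : _ \o _ = id); last by apply/funext => z /=; rewrite rV_consK.
by rewrite preimage_id product_measure1E// lte_mul_pinfty// ge0_fin_numE.
Qed.

HB.instance Definition _ := Measure_isSigmaFinite.Build _ _ _ lebesgue_rV_step
  step_sigma_finite.

End step.

Fixpoint lebesgue_rV n : {sigma_finite_measure set 'rV[R]_n -> \bar R} :=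
  match n with
  | 0 => \d_ (0%R : 'rV[R]_0)
  | n'.+1 => lebesgue_rV_step (lebesgue_rV n')
  end.

End lebesgue_rV.

(* Together with sigma-finiteness this characterizes lebesgue_rV n. *)
Lemma lebesgue_rV_prod (R : realType) n (A : 'I_n -> set (measurableTypeR R)) :
  (forall i, measurable (A i)) ->
  lebesgue_rV n [set x | forall i, A i (x 0 i)] =
  (\prod_(i < n) @lebesgue_measure R (A i))%E.
Proof.
elim: n A => [|n IHn] A mA.
  rewrite big_ord0 /= diracE mem_set// => -[]//.
pose S := [set x : 'rV[R]_n | forall i, A (lift ord0 i) (x 0 i)].
have SE : S = \bigcap_(i in [set: 'I_n]) (@rV_coord R n i @^-1` A (lift ord0 i)).
  by apply/seteqP; split=> [x Ax i _|x Ax i]; [exact: Ax|exact: (Ax i)].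
have mS : @measurable _ 'rV[R]_n S.
  rewrite SE; apply: fin_bigcap_measurable => // i _.
  by rewrite -[X in measurable X]setTI; exact: measurable_rV_coord.
rewrite big_ord_recl -IHn//= /lebesgue_rV_step /pushforward.
rewrite -product_measure1E//.
congr (_ _); apply/seteqP; split=> [z Az|z [A0 A1] i] /=.
  split; first by have := Az ord0; rewrite rV_consE0.
  by move=> i; have := Az (lift ord0 i); rewrite rV_consES.
by case: (unliftP ord0 i) => [j|] ->; [rewrite rV_consES; exact: A1|rewrite rV_consE0].
Qed.

Section euclidean.
Context {R : realType} {n : nat}.
Implicit Types x y : 'rV[R]_n.

Definition dotrV x y : R := \sum_i x 0 i * y 0 i.

(* The norm `|x| of the library on 'rV[R]_n is the sup norm. *)
Definition enorm x : R := Num.sqrt (dotrV x x).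

Definition dist_set (A : set 'rV[R]_n) x : R := inf [set enorm (x - y) | y in A].

Definition boundary (A : set 'rV[R]_n) : set 'rV[R]_n := closure A `\` interior A.

(* A connected set may be empty in the library. *)
Definition domain (A : set 'rV[R]_n) : Prop :=
  [/\ open A, connected A & A !=set0].

Definition partial (i : 'I_n) (f : 'rV[R]_n -> R) : 'rV[R]_n -> R :=
  fun x => 'D_(delta_mx 0 i) f x.

(* For locally Lipschitz f this is the almost everywhere gradient: where a
   partial derivative does not exist, the entry is the default value of lim. *)
Definition grad (f : 'rV[R]_n -> R) x : 'rV[R]_n := \row_i partial i f x.

Fixpoint Ck (k : nat) (f : 'rV[R]_n -> R) : Prop :=
  continuous f /\
  if k is k'.+1 then
    forall i, (forall x, derivable f x (delta_mx 0 i)) /\ Ck k' (partial i f)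
  else True.

Definition support_in (A : set 'rV[R]_n) (f : 'rV[R]_n -> R) : Prop :=
  compact (closure [set x | f x != 0]) /\ closure [set x | f x != 0] `<=` A.

(* C_0^oo(A), functions being extended by zero outside A *)
Definition test_fun (A : set 'rV[R]_n) (f : 'rV[R]_n -> R) : Prop :=
  (forall k, Ck k f) /\ support_in A f.

(* |x - y|^(p-2) (x - y) is 0 for x = y, also when p < 2 *)
Definition Cp (p : R) x y : R :=
  enorm x `^ p - enorm (x - y) `^ p
  - p * (enorm (x - y) `^ (p - 2) * dotrV (x - y) y).

Definition bdist (Omega : set 'rV[R]_n) : 'rV[R]_n -> R :=
  dist_set (boundary Omega).

(* <Delta d_Omega, psi>, for psi Lipschitz with compact support in Omega *)
Definition lap_bdist (Omega : set 'rV[R]_n) (psi : 'rV[R]_n -> R) : R :=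
  - \int[lebesgue_rV n]_(x in Omega) dotrV (grad (bdist Omega) x) (grad psi x).

(* c Delta d_Omega >= 0 in the sense of distributions *)
Definition scaled_lap_bdist_ge0 (Omega : set 'rV[R]_n) (c : R) : Prop :=
  forall psi, test_fun Omega psi -> (forall x, 0 <= psi x) ->
    0 <= c * lap_bdist Omega psi.

End euclidean.

(* Main.v *)
Require Import Defs.
From mathcomp Require Import all_boot all_order all_algebra.
From mathcomp Require Import all_classical all_reals all_analysis.
From mathcomp Require Import measurable_realfun ring lra.
Import Order.TTheory GRing.Theory Num.Theory.
Import numFieldNormedType.Exports.
Local Open Scope classical_set_scope.
Local Open Scope ring_scope.

(* Put c = (p + lambda - 1) / p. The weight is chosen so that, wherever
   |grad d| = 1, the two sides of the identity agree pointwise: expanding C_p at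
   x - y = c (u / d) grad d leaves exactly c |c|^(p-2) grad d . grad psi, so
   nothing is integrated by parts.
   That |grad d| = 1 almost everywhere comes from the convexity of
   h(x) = (|x|^2 - d(x)^2) / 2 = sup_y (x . y - |y|^2 / 2), y in the boundary:
   on each line parallel to an axis, h is derivable outside a countable set, and
   where the partial derivatives exist they are those of x . y for any nearest
   point y, whence grad d = (x - y) / |x - y|.
   For the sign, C_p >= 0 by convexity of |.|^p. The distributional hypothesis
   only concerns smooth functions, whereas psi = |u|^p d^(1-p-lambda) is merely
   Lipschitz. Writing h as the supremum over a sequence of affine functions and
   replacing it with the smooth convex log-sum-exp functions h_k <= h,
   the test functions
     u^2 (u^2 + e_k)^((p-2)/2) (|x|^2 - 2 h_k + e_k)^((1-p-lambda)/2)
   have gradients converging boundedly almost everywhere to that of psi, since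
   derivatives of convex functions converge wherever the limit is derivable. *)

Set Implicit Arguments.
Unset Strict Implicit.
Unset Printing Implicit Defensive.

(* Unification tends to unfold [nbhs x] for [x : 'rV[R]_n], which defeats the
   inference of the generic instance. *)
#[local] Instance rV_nbhs_filter {R : realType} {n} (x : 'rV[R]_n) :
  Filter (nbhs x) := nbhs_filter x.

(** * Measurability of open sets, continuous functions and partial derivatives *)

Section measurability_rV.
Context {R : realType} {n : nat}.
Implicit Types (f : 'rV[R]_n -> R) (A U : set 'rV[R]_n).

Lemma measurable_rV_ball (x : 'rV[R]_n) (e : R) : measurable (ball x e).
Proof.
have [e0|e0] := leP e 0.
  rewrite (_ : ball x e = set0) //; apply/seteqP; split => // y [] /=.
  by rewrite ltNge e0.
rewrite (_ : ball x e =
    \bigcap_(i in [set: 'I_n]) (@rV_coord R n i @^-1` ball (x 0 i) e)).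
  apply: fin_bigcap_measurable => // i _.
  rewrite -[X in measurable X]setTI; apply: measurable_rV_coord => //.
  by apply: open_measurable; exact: ball_open.
apply/seteqP; split => [y [_ xy] i _|y xy]; first exact: xy.
by split => // i j; rewrite (ord1 i); exact: xy.
Qed.

Lemma rat_rV_ball (x : 'rV[R]_n) (e : R) : 0 < e ->
  exists q : 'rV[rat]_n, ball (\row_i ratr (q 0 i) : 'rV[R]_n) e x.
Proof.
move=> e0.
have H i : exists q : rat, `|ratr q - x 0 i| < e.
  have [q] := @rat_in_itvoo R (x 0 i - e) (x 0 i + e) ltac:(lra).
  by rewrite in_itv/= => qx; exists q; rewrite ltr_distl.
have /choice[q Hq] := H.
exists (\row_i q i); split => // i j; rewrite (ord1 i) !mxE.
exact: Hq.
Qed.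

(** The sigma-algebra is generated by the coordinates, so an open set is exhibited as a countable
    union of balls with rational centres and radii 1/(k+1); a ball of the sup norm is a finite
    intersection of coordinate preimages. *)
Lemma open_measurable_rV U : open U -> measurable U.
Proof.
move=> oU.
pose B (z : 'rV[rat]_n * nat) : set 'rV[R]_n :=
  ball (\row_i ratr (z.1 0 i) : 'rV[R]_n) z.2.+1%:R^-1.
rewrite (_ : U = \bigcup_z (if `[< B z `<=` U >] then B z else set0)).
  apply: countable_bigcupT_measurable => // z.
  by case: ifP => // _; exact: measurable_rV_ball.
apply/seteqP; split => [x Ux|x [z _]]; last by case: asboolP => [BU /BU|].
have /nbhs_ballP[e /= e0 xe] : nbhs x U by exact: open_nbhs_nbhs.
have [k ke] : exists k : nat, k.+1%:R^-1 < e / 2.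
  have := @near_infty_natSinv_lt R (PosNum (divr_gt0 e0 (ltr0n _ 2))).
  by case=> k _ /(_ k (leqnn _)) ?; exists k.
have [q qx] := @rat_rV_ball x k.+1%:R^-1 ltac:(by rewrite invr_gt0).
exists (q, k) => //; case: asboolP => // -[] y qy; apply: xe.
apply: (@ball_splitr _ _ (\row_i ratr (q 0 i) : 'rV[R]_n)).
  by apply: le_ball qx; exact: ltW.
by apply: le_ball qy; exact: ltW.
Qed.

Lemma closed_measurable_rV A : closed A -> measurable A.
Proof.
move=> cA; rewrite -(setCK A); apply: measurableC; apply: open_measurable_rV.
exact: closed_openC.
Qed.

Lemma continuous_measurable_rV f : continuous f -> measurable_fun setT f.
Proof.
move=> cf; apply: (measurability _ (RGenOpens.measurableE R)).
move=> _ [_ [a [b ->]] <-]; rewrite setTI; apply: open_measurable_rV.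
by apply: open_comp => // x _; exact: cf.
Qed.

Let quot f (v x : 'rV[R]_n) (h : R) : R :=
  h^-1 *: ((f \o shift x) (h *: v) - f x).

Let quot_continuous f v h : continuous f -> continuous (quot f v ^~ h).
Proof.
move=> cf x; apply: cvgZ; first exact: cvg_cst.
apply: cvgB; last exact: cf.
apply: (@continuous_comp _ _ _ (fun z => h *: v + z) f); last exact: cf.
by apply: cvgD => //; exact: cvg_cst.
Qed.

(** Cauchy's criterion for the difference quotient. Integer parameters turn the set of derivability
    into a countable combination of sets, and the non-strict inequality makes these sets closed when
    f is continuous. *)
Lemma derivable_cauchyP f (v x : 'rV[R]_n) : derivable f x v <->
  forall k : nat, exists m : nat, forall h h' : R,
    h != 0 -> h' != 0 -> `|h| < m.+1%:R^-1 -> `|h'| < m.+1%:R^-1 ->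
    `|quot f v x h - quot f v x h'| <= k.+1%:R^-1.
Proof.
split=> [/cvgrPdist_lt dfx k|H].
  have /dfx : 0 < k.+1%:R^-1 / 2 :> R by rewrite divr_gt0// invr_gt0.
  move=> /nbhs_ballP[e /= e0 He].
  have [m me] : exists m : nat, m.+1%:R^-1 < e.
    have [m _ /(_ m (leqnn _)) ?] := @near_infty_natSinv_lt R (PosNum e0).
    by exists m.
  exists m => h h' h0 h'0 hm h'm.
  have H t : t != 0 -> `|t| < m.+1%:R^-1 ->
      `|'D_v f x - quot f v x t| < k.+1%:R^-1 / 2.
    move=> t0 tm; apply: He => //.
    by rewrite /ball/= sub0r normrN (lt_trans tm).
  rewrite [leRHS]splitr (le_trans (ler_distD ('D_v f x) _ _))//.
  by rewrite lerD ?ltW// ?H// distrC H.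
apply/cauchy_cvgP/cauchyP => e e0.
have [k _ /(_ k (leqnn _)) ke] := @near_infty_natSinv_lt R (PosNum e0).
have [m Hm] := H k.
have m0 : 0 < m.+1%:R^-1 :> R by rewrite invr_gt0.
exists (quot f v x (m.+1%:R^-1 / 2)).
apply/nbhs_ballP; exists m.+1%:R^-1 => //= h.
rewrite /ball /= sub0r normrN => hm h0.
apply: le_lt_trans ke; apply: Hm => //.
by rewrite ger0_norm ?divr_ge0// ?ltW// gtr_pMr// invf_lt1// ltr1n.
Qed.

Lemma measurable_derivable f v : continuous f ->
  measurable [set x | derivable f x v].
Proof.
move=> cf.
pose C (k m : nat) := [set x | forall h h' : R,
    h != 0 -> h' != 0 -> `|h| < m.+1%:R^-1 -> `|h'| < m.+1%:R^-1 ->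
    `|quot f v x h - quot f v x h'| <= k.+1%:R^-1].
rewrite (_ : [set x | _] = \bigcap_k \bigcup_m C k m); last first.
  apply/seteqP; split => x /=.
    by move/derivable_cauchyP => H k _; have [m Hm] := H k; exists m.
  by move=> H; apply/derivable_cauchyP => k; have [m _ Hm] := H k I; exists m.
apply: bigcapT_measurable => k; apply: bigcupT_measurable => m.
apply: closed_measurable_rV.
(* The pairs of increments are uncountable, but each imposes a closed condition on x, and an
   arbitrary intersection of closed sets is closed. *)
rewrite (_ : C k m = \bigcap_(z in [set z : R * R | [/\ z.1 != 0, z.2 != 0,
      `|z.1| < m.+1%:R^-1 & `|z.2| < m.+1%:R^-1]])
    ((fun x => `|quot f v x z.1 - quot f v x z.2|) @^-1` [set y | y <= k.+1%:R^-1])).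
  apply: closed_bigI => z _; apply: closed_comp; last exact: closed_le.
  move=> x _; apply: cvg_norm; apply: cvgB; exact: quot_continuous.
apply/seteqP; split => [x Cx [h h'] [] /= *|x H h h' *]; first exact: Cx.
by apply: (H (h, h')).
Qed.

(** Where the derivative exists it is the pointwise limit of the continuous quotients with
    increments 1/(k+1); elsewhere it is the default value 0 of [lim]. *)
Lemma measurable_partial f i : continuous f ->
  measurable_fun setT (partial i f).
Proof.
move=> cf; pose D := [set x | derivable f x (delta_mx 0 i)].
have mD : measurable D by exact: measurable_derivable.
rewrite -(setUv D); apply/measurable_funU => //; first exact: measurableC.
split.
  apply: (@measurable_fun_cvg _ _ _ _ (fun k => quot f (delta_mx 0 i) ^~ k.+1%:R^-1)).
    move=> m; apply: measurable_funTS; apply: continuous_measurable_rV.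
    exact: quot_continuous.
  move=> x Dx.
  have H : (fun h : R => quot f (delta_mx 0 i) x h) @ 0^' --> partial i f x by exact: Dx.
  apply: (cvgr_dnbhsP _ _ _).1 H _ _; split => [k|].
    by rewrite gt_eqF// invr_gt0.
  exact: cvg_harmonic.
apply: (eq_measurable_fun (cst (0 : R))); last exact: measurable_cst.
by move=> x; rewrite inE => Dx; exact/esym/(dvgP Dx).
Qed.

End measurability_rV.

(** * Lebesgue measure: null sets, compact sets, compactly supported integrands *)

Section lebesgue_rV_theory.
Context {R : realType}.
Implicit Types n : nat.

Lemma rV_consD n (a b : R) (y z : 'rV[R]_n) :
  rV_cons (a + b, y + z) = rV_cons (a, y) + rV_cons (b, z) :> 'rV[R]_n.+1.
Proof.
apply/rowP => i; rewrite [RHS]mxE; case: (unliftP ord0 i) => [j|] ->.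
  by rewrite !rV_consES /= mxE.
by rewrite !rV_consE0.
Qed.

Lemma rV_cons_delta0 n (t : R) : rV_cons (t, 0) = t *: delta_mx 0 (ord0 : 'I_n.+1).
Proof.
apply/rowP => i; rewrite [RHS]mxE [X in _ * X]mxE.
case: (unliftP ord0 i) => [j|] ->.
  by rewrite rV_consES /= mxE mulr0.
by rewrite rV_consE0 !eqxx mulr1.
Qed.

Lemma rV_cons_delta_lift n (t : R) (j : 'I_n) :
  rV_cons (0, t *: delta_mx 0 j) = t *: delta_mx 0 (lift ord0 j).
Proof.
apply/rowP => i; rewrite [RHS]mxE [X in _ * X]mxE.
case: (unliftP ord0 i) => [k|] ->.
  by rewrite rV_consES !mxE (inj_eq lift_inj).
by rewrite rV_consE0 /= mulr0.
Qed.

(** Fubini, since countable sets of reals are null. If the i-th axis lies in the last n coordinates,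
    the induction hypothesis applies to the slices at fixed first coordinate. *)
Lemma lebesgue_rV_countable_lines n (i : 'I_n) (A : set 'rV[R]_n) :
  measurable A ->
  (forall x, countable [set t : R | A (x + t *: delta_mx 0 i)]) ->
  lebesgue_rV n A = 0%E.
Proof.
elim: n i A => [[]//|n IHn] i A mA cA.
have mA' : measurable (@rV_cons R n @^-1` A).
  by rewrite -[X in measurable X]setTI; exact: measurable_rV_cons.
rewrite /= /lebesgue_rV_step /pushforward.
case: (unliftP ord0 i) cA => [j|] -> cA.
  rewrite /product_measure1 integral0_eq// => t _ /=.
  apply: (IHn j); first exact: measurable_xsection.
  move=> y; apply: sub_countable (cA (rV_cons (t, y))).
  apply: subset_card_le => s /=; rewrite /xsection /= inE /= => H.
  by rewrite -rV_cons_delta_lift -rV_consD addr0.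
(* Here the lines run along the first factor, so the order of integration is exchanged, by
   uniqueness of the product measure. *)
rewrite (@product_measure_unique _ _ _ _ _ _ _
  (@product_measure2 _ _ _ _ R (@lebesgue_measure R) (lebesgue_rV n))) //; last first.
  by move=> B C mB mC; exact: product_measure2E.
rewrite /= /product_measure2 integral0_eq// => y _ /=.
apply: countable_lebesgue_measure0.
apply: sub_countable (cA (rV_cons (0, y))).
apply: subset_card_le => s /=; rewrite /ysection /= inE /= => H.
by rewrite -rV_cons_delta0 -rV_consD add0r addr0.
Qed.

Lemma lebesgue_rV_compact n (K : set 'rV[R]_n) :
  compact K -> (lebesgue_rV n K < +oo)%E.
Proof.
move=> cK; have [M [_ HM]] := compact_bounded cK.
(* Boundedness only says that every number greater than M bounds K, hence the cube of half-side
   [|M| + 1]. *)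
pose B : set 'rV[R]_n :=
  [set x | forall i, x 0 i \in `[- (`|M| + 1), `|M| + 1]].
have KB : K `<=` B.
  move=> x Kx i; rewrite in_itv/= -ler_norml.
  have : `|x| <= `|M| + 1 by apply: HM => //;
    rewrite (le_lt_trans (ler_norm M))// ltrDl.
  apply: le_trans; rewrite [X in _ <= X]/Num.norm/= mx_normrE.
  exact: (le_bigmax _ (fun ij : 'I_1 * 'I_n => `|x ij.1 ij.2|) (0, i)).
have mK : measurable K.
  by apply: closed_measurable_rV; apply: compact_closed => //;
    exact: norm_hausdorff.
have mB : measurable B.
  rewrite (_ : B = \bigcap_(i in [set: 'I_n])
      (@rV_coord R n i @^-1` `[- (`|M| + 1), `|M| + 1])).
    apply: fin_bigcap_measurable => // i _.
    by rewrite -[X in measurable X]setTI; apply: measurable_rV_coord.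
  by apply/seteqP; split=> [x Bx i _|x Bx i]; [exact: Bx|exact: (Bx i)].
apply: (@le_lt_trans _ _ (lebesgue_rV n B)).
  by apply: le_measure => //; rewrite inE.
rewrite (@lebesgue_rV_prod R n (fun=> `[- (`|M| + 1), `|M| + 1]%classic)) //.
rewrite ltey_eq prode_fin_num// => i _.
by rewrite lebesgue_measure_itv/=; case: ifP.
Qed.

Lemma integrable_compact_support n (D K : set 'rV[R]_n) (f : 'rV[R]_n -> R) M :
  measurable D -> compact K -> measurable_fun D f ->
  (forall x, D x -> `|f x| <= M) -> (forall x, D x -> ~ K x -> f x = 0) ->
  (lebesgue_rV n).-integrable D (EFin \o f).
Proof.
move=> mD cK mf fM f0.
have mK : measurable K.
  by apply: closed_measurable_rV; apply: compact_closed => //;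
    exact: norm_hausdorff.
apply: (@le_integrable _ _ _ _ _ mD _ (fun x => M%:E * (\1_K x)%:E)%E).
- exact/measurable_EFinP.
- move=> x Dx; rewrite -EFinM !abse_EFin lee_fin indicE.
  case: (pselect (K x)) => Kx.
    by rewrite mem_set// mulr1 (le_trans (fM _ Dx))// ler_norm.
  by rewrite memNset// f0// mulr0 !normr0.
- apply: integrableZl => //; apply/integrableP; split.
    exact/measurable_EFinP/measurable_indic.
  under eq_integral do rewrite gee0_abs ?lee_fin//.
  rewrite integral_indic//; apply: le_lt_trans (lebesgue_rV_compact cK).
  by apply: le_measure; rewrite ?inE//; exact: measurableI.
Qed.

Lemma compact_continuous_bounded n (K : set 'rV[R]_n) (f : 'rV[R]_n -> R) :
  compact K -> (forall x, K x -> {for x, continuous f}) ->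
  exists M, forall x, K x -> `|f x| <= M.
Proof.
move=> cK cf.
have : compact (f @` K).
  apply: continuous_compact => //; apply: continuous_in_subspaceT => x.
  by rewrite inE => /cf.
move=> /compact_bounded[M [_ HM]].
exists (`|M| + 1) => x Kx; apply: HM; last by exists x.
by rewrite (le_lt_trans (ler_norm M))// ltrDl.
Qed.

End lebesgue_rV_theory.

(** * Directional derivatives as derivatives along lines *)

Section directional_derivative.
Context {R : realType} {V : normedModType R}.
Implicit Types (f : V -> R) (x v : V).

Let derive_line_quot f x v :
  (fun h : R => h^-1 *: (((fun h : R => f (h *: v + x)) \o shift 0) (h *: 1) -
    f (0 *: v + x))) =
  (fun h : R => h^-1 *: ((f \o shift x) (h *: v) - f x)).
Proof.
by apply/funext => h /=; rewrite addr0 scale0r add0r [_%:A]mulr1.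
Qed.

Lemma is_derive_line f x v (df : R) :
  is_derive x v f df <-> is_derive (0 : R) (1 : R) (fun h => f (h *: v + x)) df.
Proof.
split=> -[fxv fdf]; split.
- by rewrite /derivable derive_line_quot.
- by rewrite /derive derive_line_quot.
- by rewrite /derivable -derive_line_quot.
- by rewrite /derive -derive_line_quot.
Qed.

(** Restriction to a line reduces this to the chain rule in one variable. It asks of f a derivative
    in the direction v alone, which is all that is known of the distance function at the points
    considered later. *)
Lemma is_derive_compR f (phi : R -> R) x v (df dphi : R) :
  is_derive x v f df -> is_derive (f x) 1 phi dphi ->
  is_derive x v (phi \o f) (dphi * df).
Proof.
move=> /is_derive_line fdf phid; apply/is_derive_line.
apply: (@is_derive1_comp _ phi (fun h => f (h *: v + x)) 0 dphi df).
by rewrite scale0r add0r.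
Qed.

Lemma derivable_lineP f x v (t : R) :
  derivable f (x + t *: v) v <-> derivable (fun h : R => f (x + h *: v)) t 1.
Proof.
rewrite /derivable.
suff -> : (fun h : R => h^-1 *: ((f \o shift (x + t *: v)) (h *: v) -
      f (x + t *: v))) =
    (fun h : R => h^-1 *: (((fun h : R => f (x + h *: v)) \o shift t) (h *: 1) -
      f (x + t *: v))) by [].
apply/funext => h /=; rewrite [_%:A]mulr1 scalerDl.
by rewrite addrCA.
Qed.

End directional_derivative.

(** * Subgradients of functions of one real variable *)

Lemma subgradient_derive {R : realType} (g : R -> R) (t s : R) :
  (forall r, g t + s * (r - t) <= g r) -> derivable g t 1 -> 'D_1 g t = s.
Proof.
move=> gs /cvgrPdist_le H; apply/eqP; rewrite -subr_eq0 -normr_le0.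
apply/ler_addgt0Pl => e e0; rewrite addr0.
have /H/nbhs_ballP[d /= d0 Hd] : 0 < e by [].
have d20 : 0 < d / 2 by rewrite divr_gt0.
have Hq (h : R) : `|h| = d / 2 ->
    `|'D_1 g t - h^-1 * (g (h + t) - g t)| <= e.
  move=> hd; have := Hd h; rewrite [_%:A]mulr1; apply.
    by rewrite /ball/= sub0r normrN hd gtr_pMr// invf_lt1// ltr1n.
  by rewrite -normr_gt0 hd.
(* The subgradient s lies between the quotients with increments -d/2 and d/2, both of which are
   e-close to the derivative. *)
have : s <= (d / 2)^-1 * (g (d / 2 + t) - g t).
  rewrite ler_pdivlMl// mulrC.
  by have := gs (d / 2 + t); rewrite addrK; lra.
have : (- (d / 2))^-1 * (g (- (d / 2) + t) - g t) <= s.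
  rewrite ler_ndivrMl ?oppr_lt0//.
  by have := gs (- (d / 2) + t); rewrite addrK; lra.
have := Hq (d / 2) (gtr0_norm d20).
have := Hq (- (d / 2)) ltac:(by rewrite normrN gtr0_norm).
by rewrite !ler_norml => /andP[? ?] /andP[? ?] *; apply/andP; split; lra.
Qed.

Section subgradient.
Context {R : realType}.
Variables (g s : R -> R).
Hypothesis gs : forall t r, g t + s t * (r - t) <= g r.

Let s_nd t r : t <= r -> s t <= s r.
Proof.
rewrite le_eqVlt => /predU1P[->//|tr].
have := gs t r; have := gs r t => *.
suff : 0 <= (s r - s t) * (r - t) by rewrite pmulr_lge0 ?subr_gt0// subr_ge0.
lra.
Qed.

Let quot_ge (t h : R) : 0 < h -> s t <= h^-1 * (g (h + t) - g t).
Proof.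
move=> h0; rewrite ler_pdivlMl// mulrC.
by have := gs t (h + t); rewrite addrK; lra.
Qed.

Let quot_le_next (t h : R) : 0 < h -> h^-1 * (g (h + t) - g t) <= s (h + t).
Proof.
move=> h0; rewrite ler_pdivrMl//.
by have := gs (h + t) t; rewrite opprD addrCA subrr addr0; lra.
Qed.

Let quot_le (t h : R) : h < 0 -> h^-1 * (g (h + t) - g t) <= s t.
Proof.
move=> h0; rewrite ler_ndivrMl//.
by have := gs t (h + t); rewrite addrK; lra.
Qed.

Let quot_ge_prev (t h : R) : h < 0 -> s (h + t) <= h^-1 * (g (h + t) - g t).
Proof.
move=> h0; rewrite ler_ndivlMl//.
by have := gs (h + t) t; rewrite opprD addrCA subrr addr0; lra.
Qed.

Let quotE t (h : R) :
  h^-1 *: ((g \o shift t) (h *: 1) - g t) = h^-1 * (g (h + t) - g t).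
Proof. by rewrite /= [_%:A]mulr1. Qed.

(** The hypotheses say that the nondecreasing slope s has no jump at t, on the left and on the
    right. The quotient over an interval lies between the slopes at its endpoints, so it tends to s
    t. Two rationals are used so that a failure leaves a gap between them, which identifies t. *)
Lemma subgradient_derivable t :
  (forall q1 q2 : rat, ratr q1 < ratr q2 :> R -> ratr q2 < s t ->
    exists2 r, r < t & ratr q1 < s r) ->
  (forall q1 q2 : rat, ratr q1 < ratr q2 :> R -> s t < ratr q1 ->
    exists2 r, t < r & s r < ratr q2) ->
  derivable g t 1.
Proof.
move=> Hl Hr; apply/cvg_ex; exists (s t); apply/cvgrPdist_le => e e0.
have [q2] := @rat_in_itvoo R (s t - e) (s t) ltac:(lra).
rewrite in_itv/= => /andP[eq2 q2s].
have [q1] := @rat_in_itvoo R (s t - e) (ratr q2) ltac:(lra).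
rewrite in_itv/= => /andP[eq1 q12].
have [r rt q1r] := Hl _ _ q12 q2s.
have [q3] := @rat_in_itvoo R (s t) (s t + e) ltac:(lra).
rewrite in_itv/= => /andP[sq3 q3e].
have [q4] := @rat_in_itvoo R (ratr q3) (s t + e) ltac:(lra).
rewrite in_itv/= => /andP[q34 q4e].
have [r' rt' q4r'] := Hr _ _ q34 sq3.
pose d := Num.min (t - r) (r' - t).
apply/nbhs_ballP; exists d => /=; first by rewrite lt_min !subr_gt0 rt.
move=> h; rewrite /ball/= sub0r normrN lt_min => /andP[hr hr'] h0.
rewrite -/(shift t) quotE.
have [hp|hn|/eqP] := ltgtP h 0; last by rewrite (negbTE h0).
- rewrite ltr0_norm// in hr hr'.
  have := quot_le t hp; have := quot_ge_prev t hp.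
  have : s r <= s (h + t) by apply: s_nd; lra.
  by move=> *; rewrite ler_norml; apply/andP; split; lra.
- rewrite gtr0_norm// in hr hr'.
  have := quot_ge t hn; have := quot_le_next t hn.
  have : s (h + t) <= s r' by apply: s_nd; lra.
  by move=> *; rewrite ler_norml; apply/andP; split; lra.
Qed.

(** Distinct points never share a pair of rationals, so choosing a pair for each point is an
    injection into a countable type. *)
Lemma countable_monotone_gap (gap : R -> rat * rat -> Prop) :
  (forall t t' q, t < t' -> gap t q -> ~ gap t' q) ->
  countable [set t | exists q, gap t q].
Proof.
move=> H; pose A := [set t | exists q, gap t q].
have /choice[F HF] : forall t, exists q, A t -> gap t q.
  move=> t; case: (pselect (A t)) => [[q Hq]|nA]; first by exists q.
  by exists (0, 0).
apply/countable_injP; exists (pickle \o F) => t t'; rewrite !inE => At At'.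
move=> /= /(pcan_inj pickleK) FF.
have Ht := HF _ At; have Ht' := HF _ At'; rewrite FF in Ht.
have [tt'|tt'|//] := ltgtP t t'.
  by have := H _ _ _ tt' Ht.
by have := H _ _ _ tt' Ht'.
Qed.

(** A point of non-derivability is a jump of the monotone slope, and each one-sided jump contains a
    pair of rationals, recorded by [gl] on the left and by [gr] on the right. *)
Lemma subgradient_countable : countable [set t | ~ derivable g t 1].
Proof.
pose gl (t : R) (q : rat * rat) :=
  [/\ ratr q.1 < (ratr q.2 : R), ratr q.2 < s t &
  forall r, r < t -> s r <= ratr q.1].
pose gr (t : R) (q : rat * rat) :=
  [/\ ratr q.1 < (ratr q.2 : R), s t < ratr q.1 &
  forall r, t < r -> ratr q.2 <= s r].
have cl : countable [set t | exists q, gl t q].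
  apply: countable_monotone_gap => t t' q tt' [q12 q2 _] [_ _ /(_ _ tt')].
  by lra.
have cr : countable [set t | exists q, gr t q].
  apply: countable_monotone_gap => t t' q tt' [q12 q2 /(_ _ tt') ?] [_ ? _].
  by lra.
have : countable ([set t | exists q, gl t q] `|` [set t | exists q, gr t q]).
  by rewrite -bigcup2E; apply: bigcup_countable => // -[|[|]].
apply: sub_countable; apply: subset_card_le => t /= ndg.
apply: contrapT => /not_orP[nl nr]; apply: ndg.
apply: subgradient_derivable => q1 q2 q12 q2s; apply: contrapT => H.
- apply: nl; exists (q1, q2); split => // r rt.
  by rewrite leNgt; apply/negP => ?; apply: H; exists r.
- apply: nr; exists (q1, q2); split => // r rt.
  by rewrite leNgt; apply/negP => ?; apply: H; exists r.
Qed.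

End subgradient.

(** * Scalar product and Euclidean norm *)

Section euclidean_norm.
Context {R : realType} {n : nat}.
Implicit Types x y z : 'rV[R]_n.

Lemma dotrVC x y : dotrV x y = dotrV y x.
Proof. by apply: eq_bigr => i _; rewrite mulrC. Qed.

Lemma dotrVDl x y z : dotrV (x + y) z = dotrV x z + dotrV y z.
Proof. by rewrite /dotrV -big_split; apply: eq_bigr => i _;
  rewrite mxE mulrDl. Qed.

Lemma dotrVZl a x y : dotrV (a *: x) y = a * dotrV x y.
Proof. by rewrite /dotrV mulr_sumr; apply: eq_bigr => i _;
  rewrite mxE mulrA. Qed.

Lemma dotrVDr x y z : dotrV z (x + y) = dotrV z x + dotrV z y.
Proof. by rewrite dotrVC dotrVDl !(dotrVC z). Qed.

Lemma dotrVZr a x y : dotrV x (a *: y) = a * dotrV x y.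
Proof. by rewrite dotrVC dotrVZl dotrVC. Qed.

Lemma dotrVNl x y : dotrV (- x) y = - dotrV x y.
Proof. by rewrite -scaleN1r dotrVZl mulN1r. Qed.

Lemma dotrVNr x y : dotrV x (- y) = - dotrV x y.
Proof. by rewrite dotrVC dotrVNl dotrVC. Qed.

Definition dotrV_lin := (dotrVDl, dotrVDr, dotrVZl, dotrVZr, dotrVNl, dotrVNr).

Lemma dotrV_ge0 x : 0 <= dotrV x x.
Proof. by apply: sumr_ge0 => i _; rewrite -expr2 sqr_ge0. Qed.

Lemma enorm_ge0 x : 0 <= enorm x.
Proof. exact: sqrtr_ge0. Qed.

Lemma sqr_enorm x : enorm x ^+ 2 = dotrV x x.
Proof. by rewrite sqr_sqrtr// dotrV_ge0. Qed.

Lemma coord_le_enorm x i : `|x 0 i| <= enorm x.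
Proof.
rewrite -sqrtr_sqr ler_wsqrtr// /dotrV (bigD1 i)//= expr2 lerDl.
by apply: sumr_ge0 => j _; rewrite -expr2 sqr_ge0.
Qed.

Lemma enorm_eq0 x : (enorm x == 0) = (x == 0).
Proof.
apply/eqP/eqP => [x0|->].
  apply/rowP => i; rewrite mxE; apply/eqP; rewrite -normr_le0 -x0.
  exact: coord_le_enorm.
by rewrite /enorm /dotrV big1 ?sqrtr0// => i _; rewrite mxE mul0r.
Qed.

Lemma enormN x : enorm (- x) = enorm x.
Proof. by rewrite /enorm !dotrV_lin opprK. Qed.

Lemma enormZ a x : enorm (a *: x) = `|a| * enorm x.
Proof.
by rewrite /enorm !dotrV_lin mulrA -expr2 sqrtrM ?sqr_ge0// sqrtr_sqr.
Qed.

(** Cauchy-Schwarz: for nonzero vectors, expand the squared norm of |y| x - |x| y and divide by 2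
    |x| |y|. *)
Lemma dotrV_le_enorm x y : dotrV x y <= enorm x * enorm y.
Proof.
have [/eqP|x0] := eqVneq (enorm x) 0.
  rewrite enorm_eq0 => /eqP ->.
  rewrite -(scale0r 0) dotrVZl mul0r; apply: mulr_ge0; exact: enorm_ge0.
have [/eqP|y0] := eqVneq (enorm y) 0.
  rewrite enorm_eq0 => /eqP ->.
  rewrite -(scale0r 0) dotrVZr mul0r; apply: mulr_ge0; exact: enorm_ge0.
have xp : 0 < enorm x by rewrite lt_neqAle eq_sym x0 enorm_ge0.
have yp : 0 < enorm y by rewrite lt_neqAle eq_sym y0 enorm_ge0.
have := dotrV_ge0 (enorm y *: x - enorm x *: y).
rewrite !dotrV_lin -!sqr_enorm (dotrVC y x) => H.
have {}H : 0 <= (2 * (enorm x * enorm y)) * (enorm x * enorm y - dotrV x y) by nra.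
by move: H; rewrite pmulr_rge0 ?subr_ge0// !mulr_gt0.
Qed.

Lemma ler_enormD x y : enorm (x + y) <= enorm x + enorm y.
Proof.
rewrite -ler_sqr ?nnegrE ?addr_ge0 ?enorm_ge0// sqr_enorm.
rewrite !dotrV_lin (dotrVC y x) sqrrD !sqr_enorm.
have := dotrV_le_enorm x y; lra.
Qed.

Lemma continuous_at_rV_sum (f : 'I_n -> 'rV[R]_n -> R) x :
  (forall i, {for x, continuous (f i)}) ->
  {for x, continuous (fun x => \sum_i f i x)}.
Proof.
move=> cf; suff H r : (fun x => \sum_(i <- r) f i x) @ x --> \sum_(i <- r) f i x.
  exact: H.
elim: r => [|i r IHr].
  by under eq_fun do rewrite big_nil; rewrite big_nil; exact: cvg_cst.
under eq_fun do rewrite big_cons.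
by rewrite big_cons; apply: cvgD => //; exact: cf.
Qed.

Lemma continuous_rV_sum (f : 'I_n -> 'rV[R]_n -> R) :
  (forall i, continuous (f i)) -> continuous (fun x => \sum_i f i x).
Proof. by move=> cf x; apply: continuous_at_rV_sum => i; exact: cf. Qed.

Lemma continuous_dotrVV : continuous (fun x => dotrV x x).
Proof.
by apply: continuous_rV_sum => i x; apply: cvgM; exact: coord_continuous.
Qed.

Lemma continuous_enorm : continuous (@enorm R n).
Proof.
move=> x; apply: (@continuous_comp _ _ _ (fun x => dotrV x x) Num.sqrt).
  exact: continuous_dotrVV.
exact: sqrt_continuous.
Qed.

Lemma continuous_enormB x : continuous (fun z => enorm (x - z)).
Proof.
move=> z; apply: (@continuous_comp _ _ _ (fun z => x - z) (@enorm R n)).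
  by apply: cvgB; [exact: cvg_cst|exact: cvg_id].
exact: continuous_enorm.
Qed.

End euclidean_norm.

(** * The distance to a set and the associated convex function *)

Section distance.
Context {R : realType} {n : nat}.
Variable A : set 'rV[R]_n.
Hypothesis A0 : A !=set0.
Implicit Types x y z : 'rV[R]_n.
Local Notation d := (dist_set A).

Let Dx0 x : [set enorm (x - y) | y in A] !=set0.
Proof. by have [y Ay] := A0; exists (enorm (x - y)), y. Qed.

Let Dlb x : has_lbound [set enorm (x - y) | y in A].
Proof. by exists 0 => _ [y _ <-]; exact: enorm_ge0. Qed.

Lemma dist_set_le x y : A y -> d x <= enorm (x - y).
Proof. by move=> Ay; apply: ge_inf => //; exists y. Qed.

Lemma dist_set_ge0 x : 0 <= d x.
Proof. by apply: lb_le_inf => // _ [y _ <-]; exact: enorm_ge0. Qed.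

Lemma dist_set_adherent x e : 0 < e -> exists2 y, A y & enorm (x - y) < d x + e.
Proof.
move=> e0; have [|_ [y Ay <-] ?] :=
  @inf_adherent _ [set enorm (x - y) | y in A] _ e0.
  by split.
by exists y.
Qed.

Lemma dist_set_lip x z : d x <= d z + enorm (x - z).
Proof.
apply/ler_addgt0Pl => e e0.
have [y Ay ?] := dist_set_adherent z e0.
have := dist_set_le x Ay; have := ler_enormD (x - z) (z - y).
by rewrite addrA subrK; lra.
Qed.

Lemma continuous_dist_set : continuous d.
Proof.
move=> x; apply/cvgrPdist_le => e e0.
have := @continuous_enormB _ _ x x; rewrite /continuous_at subrr.
rewrite (_ : enorm 0 = 0); last by apply/eqP; rewrite enorm_eq0.
move=> /cvgrPdist_le /(_ _ e0); apply: filterS => z.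
rewrite sub0r normrN ger0_norm ?enorm_ge0// => xz.
have := dist_set_lip x z; have := dist_set_lip z x.
rewrite -[enorm (z - x)]enormN opprB ler_norml => ? ?.
by apply/andP; split; lra.
Qed.

Hypothesis cA : closed A.

(** The points of A no farther from x than a given point of A form a closed bounded set, hence a
    compact one, on which the distance to x attains its minimum. *)
Lemma dist_set_nearest x : exists2 y, A y & d x = enorm (x - y).
Proof.
have [y0 Ay0] := A0.
pose B := A `&` [set y | enorm (x - y) <= enorm (x - y0)].
have cxy := @continuous_enormB _ _ x.
have clB : closed B.
  apply: closedI => //.
  apply: (@closed_comp _ _ (fun y => enorm (x - y)) [set t | t <= enorm (x - y0)]).
    by move=> z _; exact: cxy.
  exact: closed_le.
have bB : bounded_set B.
  exists (`|x| + enorm (x - y0)); split; first exact: num_real.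
  move=> M HM y [_ /= By]; rewrite (le_trans _ (ltW HM))//.
  rewrite -[y](subrK x) addrC (le_trans (ler_normD _ _))// lerD2l.
  rewrite [X in X <= _]/Num.norm/= mx_normrE; apply/bigmax_leP; split.
    exact: enorm_ge0.
  move=> [i j] _ /=; rewrite (ord1 i) (le_trans (coord_le_enorm _ _))//.
  by rewrite -enormN opprB.
have B0 : B !=set0 by exists y0; split => /=.
have [y yB Hy] := compact_EVT_min B0 (bounded_closed_compact bB clB)
  (continuous_subspaceT cxy).
move: yB; rewrite inE => -[Ay By]; exists y => //; apply/le_anti/andP; split.
  exact: dist_set_le.
apply: lb_le_inf => // _ [z Az <-].
have [zB|zB] := leP (enorm (x - z)) (enorm (x - y0)).
  by apply: Hy; rewrite inE.
by rewrite (le_trans By)// ltW.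
Qed.

Lemma dist_set_gt0 x : ~ A x -> 0 < d x.
Proof.
move=> Ax; have [y Ay ->] := dist_set_nearest x.
rewrite lt_neqAle eq_sym enorm_ge0 andbT enorm_eq0 subr_eq0.
by apply: contra_notN Ax => /eqP ->.
Qed.

(* The function |x|^2 / 2 - d(x)^2 / 2 is the supremum of the affine functions
   x . y - |y|^2 / 2 for y in A. *)
Definition dist_conj x : R := (dotrV x x - d x ^+ 2) / 2.

Lemma dist_conj_ge x y : A y -> dotrV x y - dotrV y y / 2 <= dist_conj x.
Proof.
move=> Ay; have := dist_set_le x Ay;
  rewrite -ler_sqr ?nnegrE ?enorm_ge0 ?dist_set_ge0//.
by rewrite sqr_enorm !dotrV_lin (dotrVC y x) /dist_conj; lra.
Qed.

Lemma dist_conj_nearest x y : A y -> d x = enorm (x - y) ->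
  dist_conj x = dotrV x y - dotrV y y / 2.
Proof.
move=> Ay dxy; rewrite /dist_conj dxy sqr_enorm !dotrV_lin (dotrVC y x); lra.
Qed.

(** The affine function given by a nearest point attains the supremum at x and stays below it
    elsewhere, so a nearest point is a subgradient. *)
Lemma dist_conj_subgradient x y z : A y -> d x = enorm (x - y) ->
  dist_conj x + dotrV (z - x) y <= dist_conj z.
Proof.
move=> Ay dxy; rewrite (dist_conj_nearest Ay dxy).
by have := dist_conj_ge z Ay; rewrite !dotrV_lin; lra.
Qed.

Lemma continuous_dist_conj : continuous dist_conj.
Proof.
move=> x; apply: cvgM; last exact: cvg_cst.
apply: cvgB; first exact: continuous_dotrVV.
rewrite expr2 (_ : (fun x => _) = fun x => d x * d x)//.
by apply: cvgM; exact: continuous_dist_set.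
Qed.

Lemma dotrV_delta x i (t : R) : dotrV (t *: delta_mx 0 i) x = t * x 0 i.
Proof.
rewrite dotrVZl; congr (_ * _); rewrite /dotrV (bigD1 i)//= big1 ?addr0.
  by rewrite mxE !eqxx mul1r.
by move=> j ji; rewrite mxE (negbTE ji) andbF mul0r.
Qed.

(** A choice of nearest points along the line provides the selection of slopes required by
    [subgradient_countable]. *)
Lemma dist_conj_line_subgradient x i : exists s : R -> R,
  (forall t, exists y, [/\ A y, d (x + t *: delta_mx 0 i) =
      enorm (x + t *: delta_mx 0 i - y) & s t = y 0 i]) /\
  forall t r, dist_conj (x + t *: delta_mx 0 i) + s t * (r - t) <=
    dist_conj (x + r *: delta_mx 0 i).
Proof.
have /choice[Y HY] : forall t : R, exists y, A y /\
    d (x + t *: delta_mx 0 i) = enorm (x + t *: delta_mx 0 i - y).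
  by move=> t; have [y] := dist_set_nearest (x + t *: delta_mx 0 i); exists y.
exists (fun t => Y t 0 i); split=> [t|t r].
  by exists (Y t); have [] := HY t.
have [AY dY] := HY t.
have := dist_conj_subgradient (x + r *: delta_mx 0 i) AY dY.
by rewrite opprD addrACA subrr add0r -scalerBl dotrV_delta mulrC.
Qed.

(** Where the derivative exists the slope of a subgradient is unique, so any nearest point y gives
    the same coordinate. *)
Lemma partial_dist_conj x y i : A y -> d x = enorm (x - y) ->
  derivable dist_conj x (delta_mx 0 i) -> partial i dist_conj x = y 0 i.
Proof.
move=> Ay dxy /derivableP/is_derive_line [dg]; rewrite /partial => <-.
apply: subgradient_derive dg => r.
rewrite scale0r add0r subr0.
have := dist_conj_subgradient (r *: delta_mx 0 i + x) Ay dxy.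
by rewrite addrK dotrV_delta mulrC.
Qed.


Lemma dist_conj_derivable_ae i :
  lebesgue_rV n [set x | ~ derivable dist_conj x (delta_mx 0 i)] = 0%E.
Proof.
apply: (lebesgue_rV_countable_lines (i := i)).
  rewrite (_ : [set x | _] = ~` [set x | derivable dist_conj x (delta_mx 0 i)])//.
  by apply: measurableC; apply: measurable_derivable;
    exact: continuous_dist_conj.
move=> x; have [s [_ Hs]] := dist_conj_line_subgradient x i.
apply: sub_countable (subgradient_countable Hs).
apply: subset_card_le => t /= H1 H2; apply: H1; exact/derivable_lineP.
Qed.

End distance.

(** * The gradient of the distance *)

Section distance_derivative.
Context {R : realType} {n : nat}.
Implicit Types x y z v : 'rV[R]_n.

Lemma is_derive_coord x v j : is_derive x v (fun z => z 0 j : R) (v 0 j).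
Proof.
apply/is_derive_line.
rewrite (_ : (fun h => _) = (fun h : R => h * v 0 j + x 0 j)); last first.
  by apply/funext => h; rewrite !mxE.
by apply: is_derive_eq; rewrite addr0 scaler0 add0r [LHS]mulr1.
Qed.

Lemma is_derive_dotrVV x i : is_derive x (delta_mx 0 i) (fun z => dotrV z z) (2 * x 0 i).
Proof.
apply/is_derive_line.
rewrite (_ : (fun h => _) = (fun h : R => h * h + h * (2 * x 0 i) + dotrV x x));
  last first.
  apply/funext => h; rewrite dotrVDl !dotrVDr (dotrVC x) !dotrV_delta !mxE !eqxx.
  by rewrite /= !mulr1; ring.
by apply: is_derive_eq; rewrite !scale0r !add0r addr0 [LHS]mulr1.
Qed.

Variable A : set 'rV[R]_n.
Hypotheses (A0 : A !=set0) (cA : closed A).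
Local Notation d := (dist_set A).

(** The distance is the square root of |x|^2 - 2 [dist_conj], whose value at x is d(x)^2 > 0 and
    whose partial derivative is 2 x_i - 2 y_i. *)
Lemma is_derive_dist_set x y i : 0 < d x -> A y -> d x = enorm (x - y) ->
  derivable (dist_conj A) x (delta_mx 0 i) ->
  is_derive x (delta_mx 0 i) d ((x - y) 0 i / d x).
Proof.
move=> dx0 Ay dxy dh.
have dE : d = Num.sqrt \o (fun z => dotrV z z - 2 * dist_conj A z).
  apply/funext => z; rewrite /= /dist_conj mulrCA divff// mulr1 opprB addrCA subrr addr0.
  by rewrite sqrtr_sqr ger0_norm// dist_set_ge0.
have sq : dotrV x x - 2 * dist_conj A x = d x ^+ 2.
  rewrite /dist_conj; lra.
have Dh : is_derive x (delta_mx 0 i) (dist_conj A) (y 0 i).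
  by have := derivableP dh; rewrite -(partial_dist_conj A0 Ay dxy dh).
have Dq : is_derive x (delta_mx 0 i) (fun z => dotrV z z - 2 * dist_conj A z)
    (2 * x 0 i - 2 * y 0 i).
  have D1 := is_derive_dotrVV x i.
  exact: is_deriveB.
have Ds := @is_derive1_sqrt R (dotrV x x - 2 * dist_conj A x) ltac:(by rewrite sq exprn_gt0).
rewrite [X in is_derive _ _ X](dE).
apply: is_derive_eq (is_derive_compR Dq Ds) _.
rewrite sq sqrtr_sqr gtr0_norm// !mxE.
by field; rewrite gt_eqF.
Qed.

Lemma grad_dist_set x y : 0 < d x -> A y -> d x = enorm (x - y) ->
  (forall i, derivable (dist_conj A) x (delta_mx 0 i)) ->
  grad d x = (d x)^-1 *: (x - y).
Proof.
move=> dx0 Ay dxy dh; apply/rowP => i; rewrite mxE mxE.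
have := is_derive_dist_set dx0 Ay dxy (dh i).
by move=> /@derive_val; rewrite /partial => ->; rewrite mulrC.
Qed.

Lemma enorm_grad_dist_set x : 0 < d x ->
  (forall i, derivable (dist_conj A) x (delta_mx 0 i)) -> enorm (grad d x) = 1.
Proof.
move=> dx0 dh; have [y Ay dxy] := dist_set_nearest A0 cA x.
rewrite (grad_dist_set dx0 Ay dxy dh) enormZ -dxy gtr0_norm ?invr_gt0//.
by rewrite mulVf// gt_eqF.
Qed.

(** The quotients of a 1-Lipschitz function are bounded by 1, and without a derivative the value is
    0. Holding at every point, the bound serves to dominate integrands. *)
Lemma partial_dist_set_le1 x i : `|partial i d x| <= 1.
Proof.
case: (pselect (derivable d x (delta_mx 0 i))) => [|H]; last first.
  rewrite /partial /derive (_ : lim _ = 0) ?normr0//.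
  exact: (dvgP H).
move=> dd; have Hq (h : R) : h != 0 ->
    `|h^-1 *: ((d \o shift x) (h *: delta_mx 0 i) - d x)| <= 1.
  move=> h0; rewrite normrM normfV ler_pdivrMl ?normr_gt0// mulr1 /=.
  have he : enorm (h *: delta_mx 0 i : 'rV[R]_n) = `|h|.
    rewrite enormZ /enorm -[X in dotrV X _]scale1r dotrV_delta mxE !eqxx.
    by rewrite !mul1r sqrtr1 mulr1.
  have := dist_set_lip A0 (h *: delta_mx 0 i + x) x.
  have := dist_set_lip A0 x (h *: delta_mx 0 i + x).
  rewrite addrK opprD addrCA subrr addr0 enormN he ler_norml => ? ?.
  by apply/andP; split; lra.
rewrite ler_norml; apply/andP; split.
  apply: limr_ge => //; near=> h.
  have : h != 0 by near: h; exact: nbhs_dnbhs_neq.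
  by move=> /Hq; rewrite ler_norml => /andP[].
apply: limr_le => //; near=> h.
have : h != 0 by near: h; exact: nbhs_dnbhs_neq.
by move=> /Hq; rewrite ler_norml => /andP[].
Unshelve. all: by end_near. Qed.

End distance_derivative.

(** * The boundary of a proper domain *)

Section domain_boundary.
Context {R : realType} {n : nat}.
Variable Omega : set 'rV[R]_n.
Hypotheses (domO : domain Omega) (OT : Omega <> setT).

(** Otherwise Omega is open and closed, and so is its trace on the line through a point of Omega and
    a point outside; since the real line is connected, this trace is the whole line. *)
Lemma boundary_nonempty : boundary Omega !=set0.
Proof.
have [oO cO [a Oa]] := domO.
apply/set0P/eqP => b0.
have clO : closed Omega.
  rewrite closure_id; apply/seteqP; split; first exact: subset_closure.
  move=> x cx; apply: contrapT => Ox.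
  suff : boundary Omega x by rewrite b0.
  by split => //; rewrite (interior_id _).1.
have [b Ob] : exists b, ~ Omega b.
  apply: contrapT => H; apply: OT; apply/seteqP; split => // x _.
  by apply: contrapT => Ox; apply: H; exists x.
pose g (t : R) := a + t *: (b - a).
have cg : continuous g.
  move=> t; apply: cvgD; first exact: cvg_cst.
  by apply: cvgZr_tmp; exact: cvg_id.
have /connected_intervalP cT : is_interval [set: R] by [].
have H : g @^-1` Omega = setT.
  apply: cT.
  - by exists 0; rewrite /preimage /= /g scale0r addr0.
  - exists (g @^-1` Omega); last by rewrite setTI.
    by apply: open_comp => // x _; exact: cg.
  - exists (g @^-1` Omega); last by rewrite setTI.
    by apply: closed_comp => // x _; exact: cg.
have : (g @^-1` Omega) 1 by rewrite H.
by rewrite /preimage /= /g scale1r addrC subrK.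
Qed.

Lemma closed_boundary : closed (boundary Omega).
Proof.
have [oO _ _] := domO.
rewrite /boundary setDE; apply: closedI; first exact: closed_closure.
exact/open_closedC/open_interior.
Qed.

Lemma bdist_gt0 x : Omega x -> 0 < bdist Omega x.
Proof.
move=> Ox; have [oO _ _] := domO.
apply: (dist_set_gt0 boundary_nonempty closed_boundary) => -[_]; apply.
by rewrite (interior_id _).1.
Qed.

End domain_boundary.

(** * Stability properties of the class C^k *)

Section smooth_functions.
Context {R : realType} {n : nat}.
Implicit Types (f g : 'rV[R]_n -> R) (k : nat).

Lemma Ck_continuous k f : Ck k f -> continuous f.
Proof. by case: k => [|k] []. Qed.

Lemma Ck_is_derive k f x i : Ck k.+1 f ->
  is_derive x (delta_mx 0 i) f (partial i f x).
Proof. by move=> [_ /(_ i)[df _]]; exact: derivableP. Qed.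

Lemma Ck_partial k f i : Ck k.+1 f -> Ck k (partial i f).
Proof. by move=> [_ /(_ i)[]]. Qed.

(** Introduction rule with an explicit formula for the partial derivatives, so that the closure
    properties below follow by induction on k. *)
Lemma CkSI k f (df : 'I_n -> 'rV[R]_n -> R) : continuous f ->
  (forall i x, is_derive x (delta_mx 0 i) f (df i x)) ->
  (forall i, Ck k (df i)) -> Ck k.+1 f.
Proof.
move=> cf fdf Cdf; split => // i; split => [x|]; first by case: (fdf i x).
rewrite (_ : partial i f = df i)//.
by apply/funext => x; case: (fdf i x).
Qed.

Lemma CkW k f : Ck k.+1 f -> Ck k f.
Proof.
elim: k f => [f [cf _] //|k IHk f Cf].
apply: (CkSI (df := fun i => partial i f)); first exact: Ck_continuous Cf.
- by move=> i x; exact: Ck_is_derive Cf.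
- by move=> i; apply: IHk; exact: Ck_partial.
Qed.

Lemma Ck_cst k (a : R) : Ck k (cst a : 'rV[R]_n -> R).
Proof.
elim: k a => [|k IHk] a; first by split=> // x; exact: cvg_cst.
apply: (CkSI (df := fun _ => cst 0)) => // x.
exact: cvg_cst.
Qed.

Lemma CkD k f g : Ck k f -> Ck k g -> Ck k (fun x => f x + g x).
Proof.
elim: k f g => [f g [cf _] [cg _]|k IHk f g Cf Cg].
  by split => // x; apply: cvgD; [exact: cf|exact: cg].
apply: (CkSI (df := fun i x => partial i f x + partial i g x)).
- by move=> x; apply: cvgD;
  [exact: (Ck_continuous Cf)|exact: (Ck_continuous Cg)].
- move=> i x; have := Ck_is_derive x i Cf; have := Ck_is_derive x i Cg => *.
  exact: is_deriveD.
- by move=> i; apply: IHk; exact: Ck_partial.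
Qed.

Lemma CkM k f g : Ck k f -> Ck k g -> Ck k (fun x => f x * g x).
Proof.
elim: k f g => [f g [cf _] [cg _]|k IHk f g Cf Cg].
  by split => // x; apply: cvgM; [exact: cf|exact: cg].
apply: (CkSI (df := fun i x => f x * partial i g x + g x * partial i f x)).
- by move=> x; apply: cvgM;
  [exact: (Ck_continuous Cf)|exact: (Ck_continuous Cg)].
- move=> i x; have := Ck_is_derive x i Cf; have := Ck_is_derive x i Cg => *.
  exact: is_deriveM.
- by move=> i; apply: CkD; apply: IHk; by [exact: CkW|exact: Ck_partial].
Qed.

Lemma Ck_sum k (I : Type) (r : seq I) (F : I -> 'rV[R]_n -> R) :
  (forall i, Ck k (F i)) -> Ck k (fun x => \sum_(i <- r) F i x).
Proof.
move=> CF; elim: r => [|i r IHr].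
  by under eq_fun do rewrite big_nil; exact: Ck_cst.
by under eq_fun do rewrite big_cons; exact: CkD.
Qed.

Lemma Ck_coord k j : Ck k (fun x : 'rV[R]_n => x 0 j).
Proof.
case: k => [|k]; first by split => // x; exact: coord_continuous.
apply: (CkSI (df := fun i => cst ((delta_mx 0 i : 'rV[R]_n) 0 j))).
- by move=> x; exact: coord_continuous.
- by move=> i x; exact: is_derive_coord.
- by move=> i; exact: Ck_cst.
Qed.

Lemma Ck_dotrV k y : Ck k (fun x : 'rV[R]_n => dotrV x y).
Proof.
by apply: Ck_sum => i; apply: CkM; [exact: Ck_coord|exact: Ck_cst].
Qed.

Lemma Ck_dotrVV k : Ck k (fun x : 'rV[R]_n => dotrV x x).
Proof. by apply: Ck_sum => i; apply: CkM; exact: Ck_coord. Qed.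

Lemma Ck_expR k f : Ck k f -> Ck k (fun x => expR (f x)).
Proof.
elim: k f => [f [cf _]|k IHk f Cf].
  split => // x; apply: (@continuous_comp _ _ _ f expR); first exact: cf.
  exact: continuous_expR.
apply: (CkSI (df := fun i x => expR (f x) * partial i f x)).
- move=> x; apply: (@continuous_comp _ _ _ f expR).
    exact: (Ck_continuous Cf).
  exact: continuous_expR.
- move=> i x; have D := Ck_is_derive x i Cf.
  exact: (is_derive_compR D (is_derive_expR (f x))).
- by move=> i; apply: CkM; [apply: IHk; exact: CkW|exact: Ck_partial].
Qed.

Lemma continuous_powR_pos (a t : R) : 0 < t ->
  {for t, continuous (@powR R ^~ a)}.
Proof.
move=> t0; have [dt _] := is_derive1_powR a t0.
exact/differentiable_continuous/derivable1_diffP.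
Qed.

Lemma Ck_powR k f (a : R) : (forall x, 0 < f x) -> Ck k f ->
  Ck k (fun x => f x `^ a).
Proof.
(* The induction is over all exponents, because differentiation lowers the exponent to a - 1. *)
move=> f0; elim: k a => [a [cf _]|k IHk a Cf].
  split => // x; apply: (@continuous_comp _ _ _ f (@powR R ^~ a));
    first exact: cf.
  exact: continuous_powR_pos.
apply: (CkSI (df := fun i x => a * f x `^ (a - 1) * partial i f x)).
- move=> x; apply: (@continuous_comp _ _ _ f (@powR R ^~ a)).
    exact: (Ck_continuous Cf).
  exact: continuous_powR_pos.
- move=> i x; have D := Ck_is_derive x i Cf.
  exact: (is_derive_compR D (is_derive1_powR a (f0 x))).
- move=> i; apply: CkM; last exact: Ck_partial.
  by apply: CkM; [exact: Ck_cst|apply: IHk; exact: CkW].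
Qed.

Lemma Ck_ln k f : (forall x, 0 < f x) -> Ck k f -> Ck k (fun x => ln (f x)).
Proof.
move=> f0; case: k => [[cf _]|k Cf].
  split => // x; apply: (@continuous_comp _ _ _ f (@ln R)); first exact: cf.
  exact: continuous_ln.
apply: (CkSI (df := fun i x => f x `^ (-1) * partial i f x)).
- move=> x; apply: (@continuous_comp _ _ _ f (@ln R)).
    exact: (Ck_continuous Cf).
  exact: continuous_ln.
- move=> i x; have D := Ck_is_derive x i Cf.
  rewrite powR_inv1 ?ltW//.
  exact: (is_derive_compR D (is_derive1_ln (f0 x))).
- by move=> i; apply: CkM; [apply: Ck_powR => //; exact: CkW|exact: Ck_partial].
Qed.

End smooth_functions.

(** * Log-sum-exp smoothing of a supremum of affine functions *)

Section log_sum_exp.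
Context {R : realType} {n : nat}.
Variable y : nat -> 'rV[R]_n.
Implicit Types (x z : 'rV[R]_n) (k j : nat).

(** Equal to (|x|^2 - |x - a|^2) / 2, the contribution of the point a to the supremum
    [dist_conj]. *)
Definition half_sq_affine (a x : 'rV[R]_n) : R := dotrV x a - dotrV a a / 2.
Local Notation l j x := (half_sq_affine (y j) x).

(** The weights 2^-(j+1) have sum at most 1, which keeps the log-sum-exp below the supremum; the
    factor k+1 sharpens the exponential as more terms enter the sum. *)
Definition lse_term k x j : R := 2^-1 ^+ j.+1 * expR (k.+1%:R * l j x).

Definition lse_sum k x : R := \sum_(0 <= j < k.+1) lse_term k x j.

(* Smooth convex approximation from below of sup_j (x . y_j - |y_j|^2 / 2). *)
Definition lse k x : R := k.+1%:R^-1 * ln (lse_sum k x).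

Lemma lse_term_gt0 k x j : 0 < lse_term k x j.
Proof. by rewrite mulr_gt0 ?expR_gt0// exprn_gt0// invr_gt0. Qed.

Lemma lse_sum_gt0 k x : 0 < lse_sum k x.
Proof.
rewrite /lse_sum big_nat_recl// ltr_wpDr ?lse_term_gt0//.
by apply: sumr_ge0 => j _; exact/ltW/lse_term_gt0.
Qed.

Lemma Ck_half_sq_affine m a : Ck m (half_sq_affine a).
Proof. by apply: CkD; [exact: Ck_dotrV|exact: Ck_cst]. Qed.

Lemma Ck_lse m k : Ck m (lse k).
Proof.
apply: CkM; first exact: Ck_cst.
apply: Ck_ln; first exact: lse_sum_gt0.
apply: Ck_sum => j; apply: CkM; first exact: Ck_cst.
by apply: Ck_expR; apply: CkM; [exact: Ck_cst|exact: Ck_half_sq_affine].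
Qed.

Lemma half_sq_affine_line a x i (t : R) :
  half_sq_affine a (t *: delta_mx 0 i + x) = half_sq_affine a x + t * a 0 i.
Proof. by rewrite /half_sq_affine dotrVDl dotrV_delta; ring. Qed.

(** A weighted mean of the i-th coordinates of the points y_j: the k+1 from the exponent cancels the
    one in front of the logarithm. *)
Lemma partial_lse k x i : partial i (lse k) x =
  (\sum_(0 <= j < k.+1) lse_term k x j * y j 0 i) / lse_sum k x.
Proof.
have D j : is_derive x (delta_mx 0 i) (fun z => lse_term k z j)
    (lse_term k x j * (k.+1%:R * y j 0 i)).
  rewrite /lse_term -mulrA.
  apply: (@is_deriveZ _ _ _ (fun z => expR (k.+1%:R * l j z))).
  have Dl : is_derive x (delta_mx 0 i) (fun z => k.+1%:R * l j z) (k.+1%:R * y j 0 i).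
    apply: (@is_deriveZ _ _ _ (half_sq_affine (y j))); apply/is_derive_line.
    under eq_fun do rewrite half_sq_affine_line.
    by apply: is_derive_eq; rewrite add0r mul1r scaler0 add0r [LHS]mulr1.
  exact: (is_derive_compR Dl (is_derive_expR (k.+1%:R * l j x))).
have DS : is_derive x (delta_mx 0 i) (lse_sum k)
    (\sum_(0 <= j < k.+1) lse_term k x j * (k.+1%:R * y j 0 i)).
  rewrite /lse_sum; elim: (index_iota 0 k.+1) => [|j r IHr].
    by under eq_fun do rewrite big_nil; rewrite big_nil; exact: is_derive_cst.
  under eq_fun do rewrite big_cons.
  by rewrite big_cons; exact: is_deriveD.
have := @is_deriveZ _ _ _ _ k.+1%:R^-1 _ _ _
  (is_derive_compR DS (is_derive1_ln (lse_sum_gt0 k x))).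
move=> [_]; rewrite /partial => ->.
rewrite [LHS]mulrCA mulr_sumr mulrC; congr (_ / _).
by apply: eq_bigr => j _; rewrite mulrCA mulKf.
Qed.

(* Jensen's inequality for exp, from expR a >= expR b * (1 + a - b). *)
Lemma lse_subgradient k x i (t : R) :
  lse k x + partial i (lse k) x * t <= lse k (t *: delta_mx 0 i + x).
Proof.
set m := partial i (lse k) x * t.
have k0 : 0 < k.+1%:R :> R by [].
suff : expR (k.+1%:R * m) * lse_sum k x <= lse_sum k (t *: delta_mx 0 i + x).
  rewrite -ler_ln ?posrE ?mulr_gt0 ?expR_gt0 ?lse_sum_gt0//.
  rewrite lnM ?posrE ?expR_gt0 ?lse_sum_gt0// expRK.
  rewrite -(ler_pM2l (x := k.+1%:R^-1)) ?invr_gt0// mulrDr mulKf//.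
  by rewrite addrC.
have E j : lse_term k (t *: delta_mx 0 i + x) j >=
    expR (k.+1%:R * m) * (lse_term k x j + k.+1%:R * t * (lse_term k x j * y j 0 i)
      - k.+1%:R * m * lse_term k x j).
  rewrite /lse_term half_sq_affine_line (mulrDr k.+1%:R (l j x)) expRD.
  set w := _ ^+ j.+1; set e := expR (_ * l j x).
  have -> : expR (k.+1%:R * (t * y j 0 i)) =
      expR (k.+1%:R * m) * expR (k.+1%:R * (t * y j 0 i) - k.+1%:R * m).
    by rewrite -expRD addrC subrK.
  have we : 0 < w * e by rewrite mulr_gt0 ?expR_gt0// exprn_gt0// invr_gt0.
  have := expR_ge1Dx (k.+1%:R * (t * y j 0 i) - k.+1%:R * m).
  rewrite -(ler_pM2l we) -(ler_pM2l (expR_gt0 (k.+1%:R * m))).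
  set Q := expR (_ - _); set P := expR (k.+1%:R * m); lra.
apply: le_trans (ler_sum _ (fun j _ => E j)).
rewrite -mulr_sumr !big_split/= sumrN -!mulr_sumr -/(lse_sum k x).
rewrite ler_pM2l ?expR_gt0//.
(* Since [m] is t times the weighted mean of the coordinates, the first-order terms cancel in the
   sum. *)
have <- : partial i (lse k) x * lse_sum k x =
    \sum_(0 <= j < k.+1) lse_term k x j * y j 0 i.
  by rewrite partial_lse divfK// gt_eqF// lse_sum_gt0.
rewrite /m; lra.
Qed.

(** Only the j-th term of the sum is kept; the loss due to its weight tends to 0 as k grows with j
    fixed. *)
Lemma lse_ge k j x : (j <= k)%N ->
  l j x + k.+1%:R^-1 * ln (2^-1 ^+ j.+1) <= lse k x.
Proof.
move=> jk.
have : lse_term k x j <= lse_sum k x.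
  rewrite /lse_sum (big_rem j)/= ?mem_index_iota// lerDl.
  by apply: sumr_ge0 => i _; exact/ltW/lse_term_gt0.
rewrite -ler_ln ?posrE ?lse_term_gt0 ?lse_sum_gt0//.
rewrite lnM ?posrE ?expR_gt0 ?exprn_gt0 ?invr_gt0// expRK.
rewrite -(ler_pM2l (x := k.+1%:R^-1)) ?invr_gt0// mulrDr mulKf//.
by rewrite addrC.
Qed.

Lemma lse_le k x M : (forall j, l j x <= M) -> lse k x <= M.
Proof.
move=> lM.
have : lse_sum k x <= expR (k.+1%:R * M).
  have -> : expR (k.+1%:R * M) = 1 * expR (k.+1%:R * M) by rewrite mul1r.
  apply: (@le_trans _ _ ((\sum_(0 <= j < k.+1) 2^-1 ^+ j.+1) * expR (k.+1%:R * M))).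
    rewrite mulr_suml; apply: ler_sum => j _.
    by rewrite ler_pM2l ?exprn_gt0 ?invr_gt0// ler_expR ler_pM2l.
  rewrite ler_pM2r ?expR_gt0//.
  suff -> : \sum_(0 <= j < k.+1) 2^-1 ^+ j.+1 = 1 - 2^-1 ^+ k.+1 :> R.
    by rewrite gerBl exprn_ge0// invr_ge0.
  elim: k {lM} => [|k IHk]; first by rewrite big_nat1 expr1; lra.
  by rewrite big_nat_recr//= IHk [in RHS]exprS [in X in _ + X]exprS; lra.
rewrite -ler_ln ?posrE ?lse_sum_gt0 ?expR_gt0// expRK.
by rewrite -(ler_pM2l (x := k.+1%:R^-1)) ?invr_gt0// mulKf.
Qed.

Lemma lse_cvg x M : (forall j, l j x <= M) ->
  (forall e : R, 0 < e -> exists j, M - e < l j x) ->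
  lse k x @[k --> \oo] --> M.
Proof.
move=> lM Ml; apply/cvgrPdist_le => e e0.
have e20 : 0 < e / 2 by rewrite divr_gt0.
have [J HJ] := Ml _ e20.
pose w : R := ln (2^-1 ^+ J.+1).
have H : (k.+1%:R^-1 * w : R) @[k --> \oo] --> 0 * w.
  by apply: cvgM; [exact: cvg_harmonic|exact: cvg_cst].
rewrite mul0r in H; move/cvgrPdist_le : H => /(_ _ e20) H.
near=> k.
have : `|0 - k.+1%:R^-1 * w| <= e / 2 by near: k.
have Jk : (J <= k)%N by near: k; exact: nbhs_infty_ge.
have := lse_ge x Jk; rewrite -/w; have := lse_le k lM.
rewrite sub0r normrN !ler_norml; set a := k.+1%:R^-1 * w => ? ? /andP[? ?].
by apply/andP; split; move: HJ; lra.
Unshelve. all: by end_near. Qed.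

End log_sum_exp.

(** The quotients of gk with increments -d/2 and d/2 enclose sk. First d is chosen so that the
    quotients of g are close to the derivative, then k so that those of gk are close to those of
    g. *)
Lemma subgradient_cvg {R : realType} (gk : nat -> R -> R) (g : R -> R)
    (sk : nat -> R) :
  (forall k r, gk k 0 + sk k * r <= gk k r) ->
  (forall r, gk k r @[k --> \oo] --> g r) ->
  derivable g 0 1 -> sk k @[k --> \oo] --> 'D_1 g 0.
Proof.
move=> gs gkg /cvgrPdist_le H; apply/cvgrPdist_le => e e0.
have e20 : 0 < e / 2 by rewrite divr_gt0.
have /H/nbhs_ballP[d /= d0 Hd] := e20.
have d20 : 0 < d / 2 by rewrite divr_gt0.
have Hq (h : R) : `|h| = d / 2 -> `|'D_1 g 0 - h^-1 * (g h - g 0)| <= e / 2.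
  move=> hd; have := Hd h; rewrite [_%:A]mulr1 addr0; apply.
    by rewrite /ball/= sub0r normrN hd gtr_pMr// invf_lt1// ltr1n.
  by rewrite -normr_gt0 hd.
have Hk (h : R) : \forall k \near \oo,
    `|h^-1 * (g h - g 0) - h^-1 * (gk k h - gk k 0)| <= e / 2.
  have : h^-1 * (gk k h - gk k 0) @[k --> \oo] --> h^-1 * (g h - g 0).
    by apply: cvgM; [exact: cvg_cst|apply: cvgB; exact: gkg].
  by move/cvgrPdist_le; apply.
near=> k.
have : `|(d / 2)^-1 * (g (d / 2) - g 0) -
  (d / 2)^-1 * (gk k (d / 2) - gk k 0)| <= e / 2 by near: k; exact: Hk.
have : `|(- (d / 2))^-1 * (g (- (d / 2)) - g 0) -
  (- (d / 2))^-1 * (gk k (- (d / 2)) - gk k 0)| <= e / 2 by near: k; exact: Hk.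
have := Hq (d / 2) (gtr0_norm d20).
have := Hq (- (d / 2)) ltac:(by rewrite normrN gtr0_norm).
have : sk k <= (d / 2)^-1 * (gk k (d / 2) - gk k 0).
  by rewrite ler_pdivlMl// mulrC; have := gs k (d / 2); lra.
have : (- (d / 2))^-1 * (gk k (- (d / 2)) - gk k 0) <= sk k.
  by rewrite ler_ndivrMl ?oppr_lt0//; have := gs k (- (d / 2)); lra.
rewrite !ler_norml => ? ? /andP[? ?] /andP[? ?] /andP[? ?] /andP[? ?].
by apply/andP; split; lra.
Unshelve. all: by end_near. Qed.

(** * The power |t|^p, its derivative and its smooth regularization *)

Section power_derivatives.
Context {R : realType}.
Implicit Types (p t e : R).

Lemma normr_powR t p : `|t| `^ p = (t * t) `^ (p / 2).
Proof.
rewrite -expr2 -real_normK ?num_real// -powR_mulrn// -powRrM.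
by rewrite mulrCA divff// mulr1.
Qed.

Lemma is_derive_normr_powR p t : 1 < p ->
  is_derive t 1 (fun s : R => `|s| `^ p) (p * (`|t| `^ (p - 2) * t)).
Proof.
move=> p1; have [->|t0] := eqVneq t 0.
  suff H : (fun h : R => h^-1 *: (((fun s : R => `|s| `^ p) \o shift 0) (h *: 1) - `|0 : R| `^ p))
      @ 0^' --> (p * (`|0 : R| `^ (p - 2) * 0)).
    split; first by apply/cvg_ex; eexists; exact: H.
    exact: (cvg_lim _ H).
  rewrite !mulr0; apply/cvgrPdist_le => e e0.
  have pm1 : 0 < p - 1 by rewrite subr_gt0.
  (* At 0 the quotient has absolute value |h|^(p-1), which is at most e within this radius. *)
  apply/nbhs_ballP; exists (e `^ (p - 1)^-1) => /=; first exact: powR_gt0.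
  move=> h; rewrite /ball/= sub0r normrN => he h0.
  rewrite [_%:A]mulr1 addr0 normr0 powR0 ?gt_eqF ?(lt_trans ltr01)// subr0 sub0r normrN.
  rewrite [X in `|X|]/GRing.scale /= normrM normfV [X in _ * X]ger0_norm ?powR_ge0//.
  have h0' : 0 < `|h| by rewrite normr_gt0.
  rewrite mulrC -powR_inv1// -powRD ?gt_eqF ?implybT//.
  have -> : e = (e `^ (p - 1)^-1) `^ (p - 1).
    by rewrite -powRrM mulVf ?gt_eqF// powRr1// ltW.
  by apply: ge0_ler_powR; rewrite ?nnegrE ?powR_ge0// ltW.
rewrite (_ : (fun s : R => _) = (@powR R ^~ (p / 2)) \o (fun s => s * s));
  last first.
  by apply/funext => s /=; exact: normr_powR.
have tt0 : 0 < t * t by rewrite -expr2 exprn_even_gt0.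
apply: is_derive_eq.
  by apply: is_derive1_comp; first exact: is_derive1_powR.
rewrite /= [t%:A]mulr1 normr_powR.
rewrite (_ : (p - 2) / 2 = p / 2 - 1); last by field.
by field.
Qed.

(** A regularization of |t|^p, smooth for e > 0. Unlike (t^2 + e)^(p/2) it vanishes at t = 0, so
    that composing it with u does not enlarge the support. *)
Definition reg_powR p e t : R := t * t * (t * t + e) `^ ((p - 2) / 2).

Definition reg_powR' p e t : R :=
  2 * t * (t * t + e) `^ ((p - 2) / 2) +
  t * t * ((p - 2) / 2 * (t * t + e) `^ ((p - 2) / 2 - 1) * (2 * t)).

Let sqDe_gt0 t e : 0 < e -> 0 < t * t + e.
Proof. by move=> e0; rewrite ltr_wpDl// -expr2 sqr_ge0. Qed.

Lemma is_derive_reg_powR p e t : 0 < e ->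
  is_derive t 1 (reg_powR p e) (reg_powR' p e t).
Proof.
move=> e0; have te := sqDe_gt0 t e0.
have D : is_derive t 1 (fun s : R => s * s + e) (2 * t).
  by apply: is_derive_eq; rewrite addr0 [t%:A]mulr1; ring.
have D2 := is_derive_compR D (is_derive1_powR ((p - 2) / 2) te).
have D3 : is_derive t 1 (fun s : R => s * s) (2 * t).
  by apply: is_derive_eq; rewrite [t%:A]mulr1; ring.
apply: is_derive_eq (is_deriveM D3 D2) _.
by rewrite /reg_powR' /= addrC; congr (_ + _); rewrite [LHS]mulrC.
Qed.

Lemma reg_powR_ge0 p e t : 0 <= reg_powR p e t.
Proof. by rewrite mulr_ge0 ?powR_ge0// -expr2 sqr_ge0. Qed.

Lemma reg_powR_le p e t : 0 < p -> 0 < e <= 1 ->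
  reg_powR p e t <= (t * t + 1) `^ (p / 2).
Proof.
move=> p0 /andP[e0 e1]; have te := sqDe_gt0 t e0.
apply: (@le_trans _ _ ((t * t + e) `^ (p / 2))).
  rewrite (_ : p / 2 = 1 + (p - 2) / 2); last by field.
  rewrite powRD ?(gt_eqF te) ?implybT// (powRr1 (ltW te)).
  by rewrite /reg_powR ler_wpM2r ?powR_ge0// lerDl ltW.
apply: ge0_ler_powR; rewrite ?nnegrE ?lerD2l//; last 2 first.
- exact: ltW.
- exact/ltW/sqDe_gt0.
by rewrite divr_ge0// ltW.
Qed.

(** The derivative factors as 2 + (p-2) t^2/(t^2+e) times t (t^2+e)^((p-2)/2). The fraction lies in
    [0, 1] and |t| <= (t^2+e)^(1/2), which leaves the exponent (p-1)/2 > 0 and a bound uniform in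
    e. *)
Lemma reg_powR'_le p e t : 1 < p -> 0 < e <= 1 ->
  `|reg_powR' p e t| <= (2 + `|p - 2|) * (t * t + 1) `^ ((p - 1) / 2).
Proof.
move=> p1 /andP[e0 e1]; have te := sqDe_gt0 t e0.
set b := (p - 2) / 2.
have Hb : `|t| * (t * t + e) `^ b <= (t * t + 1) `^ ((p - 1) / 2).
  apply: (@le_trans _ _ ((t * t + e) `^ ((p - 1) / 2))).
    rewrite (_ : (p - 1) / 2 = 2^-1 + b); last by rewrite /b; field.
    rewrite powRD ?(gt_eqF te) ?implybT//.
    rewrite ler_wpM2r ?powR_ge0// powR12_sqrt ?(ltW te)//.
    by rewrite -sqrtr_sqr ler_wsqrtr// expr2 lerDl ltW.
  apply: ge0_ler_powR; rewrite ?nnegrE ?lerD2l//; last 2 first.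
  - exact: ltW.
  - exact/ltW/sqDe_gt0.
  by rewrite divr_ge0// subr_ge0 ltW.
have E : reg_powR' p e t =
    (2 + (p - 2) * (t * t / (t * t + e))) * (t * (t * t + e) `^ b).
  rewrite /reg_powR' -/b powRB ?(gt_eqF te) ?implybT// (powRr1 (ltW te)).
  by rewrite /b; field; rewrite gt_eqF.
rewrite E normrM [X in _ * X]normrM (ger0_norm (powR_ge0 _ _)).
apply: ler_pM => //; first by rewrite mulr_ge0 ?powR_ge0.
rewrite (le_trans (ler_normD _ _))// ger0_norm// lerD2l normrM ler_piMr//.
rewrite ger0_norm ?divr_ge0 ?(ltW te)// -?expr2 ?sqr_ge0//.
by rewrite ler_pdivrMr ?mul1r ?expr2// lerDl ltW.
Qed.

Let cvg_powR_harmonic p t : t != 0 ->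
  (t * t + k.+1%:R^-1) `^ p @[k --> \oo] --> (t * t) `^ p.
Proof.
move=> t0; have tt0 : 0 < t * t by rewrite -expr2 exprn_even_gt0.
have H : (t * t + k.+1%:R^-1 : R) @[k --> \oo] --> t * t + 0.
  by apply: cvgD; [exact: cvg_cst|exact: cvg_harmonic].
rewrite addr0 in H.
exact: (continuous_cvg _ (continuous_powR_pos (a := p) tt0) H).
Qed.

Lemma reg_powR_cvg p t : 0 < p ->
  reg_powR p k.+1%:R^-1 t @[k --> \oo] --> `|t| `^ p.
Proof.
move=> p0; have [->|t0] := eqVneq t 0.
  rewrite /reg_powR normr0 powR0 ?gt_eqF//.
  by under eq_fun do rewrite !mul0r; exact: cvg_cst.
have tt0 : 0 < t * t by rewrite -expr2 exprn_even_gt0.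
rewrite normr_powR (_ : p / 2 = 1 + (p - 2) / 2); last by field.
rewrite powRD ?(gt_eqF tt0) ?implybT// (powRr1 (ltW tt0)).
by apply: cvgM; [exact: cvg_cst|exact: cvg_powR_harmonic].
Qed.

Lemma reg_powR'_cvg p t :
  reg_powR' p k.+1%:R^-1 t @[k --> \oo] --> p * (`|t| `^ (p - 2) * t).
Proof.
have [->|t0] := eqVneq t 0.
  by rewrite /reg_powR' !mulr0; under eq_fun do rewrite !mul0r addr0;
    exact: cvg_cst.
have tt0 : 0 < t * t by rewrite -expr2 exprn_even_gt0.
rewrite (_ : p * _ = 2 * t * (t * t) `^ ((p - 2) / 2) +
  t * t * ((p - 2) / 2 * (t * t) `^ ((p - 2) / 2 - 1) * (2 * t))); last first.
  rewrite normr_powR powRB ?(gt_eqF tt0) ?implybT// (powRr1 (ltW tt0)).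
  by field.
apply: cvgD; first by apply: cvgM; [exact: cvg_cst|exact: cvg_powR_harmonic].
apply: cvgM; first exact: cvg_cst.
apply: cvgM; last exact: cvg_cst.
by apply: cvgM; [exact: cvg_cst|exact: cvg_powR_harmonic].
Qed.

(** The power is monotone in its base, in a direction depending on the sign of a; the sum of both
    endpoint values covers the two cases. *)
Lemma powR_le_endpoints (a s t r : R) : 0 < s -> s <= t -> t <= r ->
  t `^ a <= s `^ a + r `^ a.
Proof.
move=> s0 st tr; have t0 := lt_le_trans s0 st; have r0 := lt_le_trans t0 tr.
have [a0|a0] := leP 0 a.
  apply: (@le_trans _ _ (r `^ a)); last by rewrite lerDr powR_ge0.
  by apply: ge0_ler_powR; rewrite ?nnegrE// ltW.
apply: (@le_trans _ _ (s `^ a)); last by rewrite lerDl powR_ge0.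
rewrite -(opprK a) !(powRN _ (- a)) lef_pV2 ?posrE ?powR_gt0//.
by apply: ge0_ler_powR; rewrite ?nnegrE ?oppr_ge0// ltW.
Qed.

End power_derivatives.

(** * A sequence of points of the set realizing the distance everywhere *)

Section nearest_sequence.
Context {R : realType} {n : nat}.
Variable A : set 'rV[R]_n.
Hypothesis A0 : A !=set0.

(** For each rational point and each k, an almost nearest point with error 1/(k+1) is chosen;
    density of the rational points and the Lipschitz property extend this to all x. *)
Lemma dist_set_sequence : exists y : nat -> 'rV[R]_n, (forall j, A (y j)) /\
  forall (x : 'rV[R]_n) (e : R), 0 < e ->
    exists j, enorm (x - y j) < dist_set A x + e.
Proof.
have /choice[Y HY] : forall z : 'rV[rat]_n * nat, exists y, A y /\
    enorm ((\row_i ratr (z.1 0 i) : 'rV[R]_n) - y) <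
      dist_set A (\row_i ratr (z.1 0 i)) + z.2.+1%:R^-1.
  move=> z; have [|y Ay ?] := @dist_set_adherent _ _ _ A0
    (\row_i ratr (z.1 0 i)) z.2.+1%:R^-1; first by rewrite invr_gt0.
  by exists y.
have [a0 Aa0] := A0.
exists (fun j => if unpickle j is Some z then Y z else a0); split => [j|x e e0].
  by case: unpickle => // z; have [] := HY z.
(* One third for the almost nearest point, and one for each use of |x - rq|: in the triangle
   inequality and in the Lipschitz bound on the distance. *)
have e30 : 0 < e / 3 by rewrite divr_gt0.
have := @continuous_enormB _ _ x x; rewrite /continuous_at subrr.
rewrite (_ : enorm 0 = 0); last by apply/eqP; rewrite enorm_eq0.
move=> /cvgrPdist_lt /(_ _ e30) /nbhs_ballP[r /= r0 Hr].
have [q qx] := rat_rV_ball x r0.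
have /Hr := ball_sym qx; rewrite sub0r normrN ger0_norm ?enorm_ge0// => xq.
have [k _ /(_ k (leqnn _)) ke] := @near_infty_natSinv_lt R (PosNum e30).
exists (pickle (q, k)); rewrite pickleK.
have [_ /= HYq] := HY (q, k).
set rq : 'rV[R]_n := \row_i _ in HYq xq.
have {}HYq := lt_trans HYq (ler_ltD (lexx _) ke).
have := dist_set_lip A0 rq x.
have := ler_enormD (x - rq) (rq - Y (q, k)).
rewrite addrA subrK -[enorm (rq - x)]enormN opprB.
move: HYq xq; rewrite /=; lra.
Qed.

Lemma half_sq_affine_sup (y : nat -> 'rV[R]_n) x : (forall j, A (y j)) ->
  (forall e : R, 0 < e -> exists j, enorm (x - y j) < dist_set A x + e) ->
  (forall j, half_sq_affine (y j) x <= dist_conj A x) /\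
  forall e : R, 0 < e -> exists j, dist_conj A x - e < half_sq_affine (y j) x.
Proof.
move=> Ay Hy; split => [j|e e0]; first exact: dist_conj_ge.
have d0 := dist_set_ge0 A0 x; set d := dist_set A x in d0 *.
(* With t <= 1 and t (2 d + 1) <= e, one has (d + t)^2 <= d^2 + e. *)
pose t := Num.min 1 (e / (2 * d + 1)).
have t0 : 0 < t by rewrite lt_min ltr01 divr_gt0// ltr_wpDl// mulr_ge0.
have [j] := Hy _ t0; rewrite -/d.
exists j.
have : enorm (x - y j) ^+ 2 < (d + t) ^+ 2.
  by rewrite ltr_sqr ?nnegrE ?enorm_ge0// addr_ge0// ltW.
rewrite sqr_enorm !dotrV_lin (dotrVC (y j) x) /half_sq_affine /dist_conj -/d.
have t1 : t <= 1 by rewrite ge_min lexx.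
have te : t * (2 * d + 1) <= e.
  by rewrite -ler_pdivlMr ?ltr_wpDl ?mulr_ge0// ge_min lexx orbT.
have : t * t <= t by rewrite ler_piMl// ltW.
by nra.
Qed.

End nearest_sequence.

(** * Nonnegativity of C_p *)

Section Cp_nonneg.
Context {R : realType} {n : nat}.

(* With z = x - y this is the convexity inequality for |.|^p at z, which follows
   from Cauchy-Schwarz and Young's inequality. *)
Lemma Cp_ge0 (p : R) (x y : 'rV[R]_n) : 1 < p -> 0 <= Cp p x y.
Proof.
move=> p1; rewrite /Cp; set z := x - y.
have -> : y = x - z by rewrite /z opprB addrC subrK.
have p0 : 0 < p := lt_trans ltr01 p1.
rewrite dotrVDr dotrVNr -sqr_enorm.
set a := enorm x; set b := enorm z.
have b0 : 0 <= b := enorm_ge0 z.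
have a0 : 0 <= a := enorm_ge0 x.
have zx : dotrV z x <= b * a by exact: dotrV_le_enorm.
have bp2 : 0 <= b `^ (p - 2) by exact: powR_ge0.
have H1 : b `^ (p - 2) * (dotrV z x - b ^+ 2) <= b `^ (p - 2) * (b * a - b ^+ 2).
  by rewrite ler_wpM2l// lerD2r.
have E1 : b `^ (p - 2) * b = b `^ (p - 1).
  have [b00|bn0] := eqVneq b 0.
    by rewrite b00 mulr0 powR0// gt_eqF// subr_gt0.
  rewrite -{2}(powRr1 b0) -powRD ?bn0 ?implybT//.
  by congr (_ `^ _); lra.
have E2 : b `^ (p - 1) * b = b `^ p.
  by rewrite mulrC mulr_powRB1.
(* Young's inequality for |x| and |z|^(p-1), with exponents p and p/(p-1). *)
have Y := @conjugate_powR _ a (b `^ (p - 1)) p (p / (p - 1)) a0 (powR_ge0 _ _) p0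
  ltac:(by rewrite divr_gt0// subr_gt0) ltac:(field; apply/andP; split; lra).
rewrite -powRrM mulrCA divff ?mulr1 in Y; last by rewrite gt_eqF// subr_gt0.
have Y2 : p * (a * b `^ (p - 1)) <= a `^ p + (p - 1) * b `^ p.
  have := Y; rewrite -(ler_pM2l p0).
  suff -> : p * (a `^ p / p + b `^ p / (p / (p - 1))) = a `^ p + (p - 1) * b `^ p by [].
  by field; apply/andP; split; lra.
have H2 : p * (b `^ (p - 2) * (b * a - b ^+ 2)) = p * (a * b `^ (p - 1)) - p * b `^ p.
  by rewrite -E2 -E1; ring.
have := H1; rewrite -(ler_pM2l p0) H2.
by move=> H3; move: Y2 H3; lra.
Qed.

End Cp_nonneg.

(** * Measurability of expressions in vector fields *)

Section measurable_vector.
Context {R : realType} {d} {T : measurableType d} {n : nat}.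
Variable D : set T.
Implicit Types V W : T -> 'rV[R]_n.

Lemma measurable_fun_dotrV V W : (forall i, measurable_fun D (fun x => V x 0 i)) ->
  (forall i, measurable_fun D (fun x => W x 0 i)) ->
  measurable_fun D (fun x => dotrV (V x) (W x)).
Proof.
move=> mV mW; rewrite /dotrV; elim: (index_enum _) => [|i r IHr].
  by under eq_fun do rewrite big_nil; exact: measurable_cst.
under eq_fun do rewrite big_cons.
by apply: measurable_funD => //; exact: measurable_funM.
Qed.

Lemma measurable_fun_enorm V : (forall i, measurable_fun D (fun x => V x 0 i)) ->
  measurable_fun D (fun x => enorm (V x)).
Proof.
move=> mV; apply: (measurableT_comp (f := @Num.sqrt R)).
  by apply: continuous_measurable_fun; exact: sqrt_continuous.
exact: measurable_fun_dotrV.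
Qed.

Lemma measurable_fun_powRl (f : T -> R) (a : R) : measurable_fun D f ->
  measurable_fun D (fun x => f x `^ a).
Proof. by move=> mf; exact: (measurableT_comp (measurable_powR a)). Qed.

Lemma measurable_fun_Cp (p : R) V W : (forall i, measurable_fun D (fun x => V x 0 i)) ->
  (forall i, measurable_fun D (fun x => W x 0 i)) ->
  measurable_fun D (fun x => Cp p (V x) (W x)).
Proof.
move=> mV mW.
have mVW i : measurable_fun D (fun x => (V x - W x) 0 i).
  under eq_fun do rewrite !mxE.
  exact: measurable_funB.
apply: measurable_funB.
  by apply: measurable_funB; apply: measurable_fun_powRl;
    exact: measurable_fun_enorm.
apply: measurable_funM; first exact: measurable_cst.
apply: measurable_funM; last exact: measurable_fun_dotrV.
by apply: measurable_fun_powRl; exact: measurable_fun_enorm.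
Qed.

End measurable_vector.

(** * Functions vanishing off a compact support *)

Section compactly_supported.
Context {R : realType} {n : nat}.
Variables (Omega : set 'rV[R]_n) (u : 'rV[R]_n -> R).
Hypothesis hu : support_in Omega u.
Local Notation K := (closure [set x | u x != 0]).

Lemma near_support x : ~ K x -> \forall z \near x, u z = 0.
Proof.
move=> Kx; have : nbhs x (~` K).
  by apply: open_nbhs_nbhs; split => //; apply: closed_openC;
    exact: closed_closure.
apply: filterS => z Kz; apply/eqP; rewrite -[_ == _]negbK; apply/negP => uz.
by apply: Kz; exact: subset_closure.
Qed.

Lemma support_eq0 x : ~ K x -> u x = 0.
Proof. by move=> /near_support/nbhs_singleton. Qed.

Lemma is_derive_off_support (f : 'rV[R]_n -> R) x i : ~ K x ->
  (forall z, u z = 0 -> f z = 0) -> is_derive x (delta_mx 0 i) f 0.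
Proof.
move=> Kx uf; have D0 : is_derive x (delta_mx 0 i) (cst 0 : 'rV[R]_n -> R) 0.
  exact: is_derive_cst.
apply: near_eq_is_derive D0.
by apply: filterS (near_support Kx) => z /uf ->.
Qed.

(** Powers of the distance may be singular on the boundary. A point either lies in the support,
    hence in Omega, or has a neighbourhood where u, and so f, vanishes. *)
Lemma continuous_off_support (f : 'rV[R]_n -> R) :
  (forall x, Omega x -> {for x, continuous f}) ->
  (forall z, u z = 0 -> f z = 0) -> continuous f.
Proof.
move=> cf uf x; have [|Kx] := pselect (K x).
  by move=> /hu.2; exact: cf.
rewrite /continuous_at (uf x) ?support_eq0//.
apply: cvg_trans (@cvg_cst _ (0 : R) _ (nbhs x) _).
apply: near_eq_cvg; apply: filterS (near_support Kx) => z /uf ->.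
by [].
Qed.

End compactly_supported.

(** * The pointwise identity *)

Lemma normr_powRB2 {R : realType} (p t : R) : 0 < p ->
  `|t| `^ p = `|t| `^ (p - 2) * t ^+ 2.
Proof.
move=> p0; have [->|t0] := eqVneq t 0.
  by rewrite normr0 powR0 ?gt_eqF// expr0n mulr0.
rewrite -real_normK ?num_real// -powR_mulrn// -powRD ?normr_eq0 ?t0 ?implybT//.
by rewrite subrK.
Qed.

(** The second argument of [Cp] is g - (c U / D) nu, so its difference from g is a multiple of the
    unit vector nu. Expanding [Cp] leaves only |g|^p, |U|^p and |U|^(p-2) U (nu . g), the last of
    which cancels against the final scalar product. *)
Lemma hardy_pointwise {R : realType} {n : nat} (g nu : 'rV[R]_n) (U D p lambda : R) :
  let c := (p + lambda - 1) / p in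
  0 < D -> enorm nu = 1 -> 1 < p ->
  enorm g `^ p / D `^ lambda - `|c| `^ p * (`|U| `^ p / D `^ (lambda + p)) =
  (D `^ lambda)^-1 *
    Cp p g (D `^ c *: (D `^ (- c) *: g + (U * (- c * D `^ (- c - 1))) *: nu)) +
  c * `|c| `^ (p - 2) * dotrV nu
   ((`|U| `^ p * ((1 - p - lambda) * D `^ (1 - p - lambda - 1))) *: nu +
    (D `^ (1 - p - lambda) * (p * (`|U| `^ (p - 2) * U))) *: g).
Proof.
move=> c D0 nu1 p1; have p0 : 0 < p := lt_trans ltr01 p1.
have Dn0 : D != 0 by rewrite gt_eqF.
have cp : c * p = p + lambda - 1 by rewrite /c divfK// gt_eqF.
(* From here on c is known only through c p = p + lambda - 1. *)
clearbody c.
have -> : D `^ c *: (D `^ (- c) *: g + (U * (- c * D `^ (- c - 1))) *: nu) =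
    g - (c * U / D) *: nu.
  rewrite scalerDr !scalerA -powRD ?Dn0 ?implybT// subrr powRr0 scale1r;
    congr (_ + _).
  rewrite -[RHS]scaleNr; congr (_ *: nu).
  rewrite powRB ?Dn0 ?implybT// powRr1 ?ltW// powRN.
  by field; rewrite Dn0 gt_eqF// powR_gt0.
rewrite /Cp.
have -> : g - (g - (c * U / D) *: nu) = (c * U / D) *: nu by rewrite opprB addrC subrK.
rewrite enormZ nu1 mulr1 !dotrV_lin -(sqr_enorm nu) nu1 expr1n.
rewrite [`|c| `^ p]normr_powRB2// [`|U| `^ p]normr_powRB2//.
rewrite [`|_ / D| `^ p]normr_powRB2//.
rewrite !normrM normfV (gtr0_norm D0) !powRM ?mulr_ge0 ?invr_ge0 ?(ltW D0)//.
have -> : 1 - p - lambda - 1 = - (lambda + p) by lra.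
have -> : 1 - p - lambda = - (lambda + (p - 1)) by lra.
have -> : (D^-1) `^ (p - 2) = (D `^ p)^-1 * D ^+ 2.
  rewrite -powR_inv1 ?ltW// -powRrM mulN1r opprB powRB ?Dn0 ?implybT//.
  by rewrite powR_mulrn ?ltW// mulrC.
rewrite !powRN !(powRD (x := D)) ?Dn0 ?implybT// powR_inv1 ?ltW//.
have X0 : D `^ lambda != 0 by rewrite gt_eqF// powR_gt0.
have P0 : D `^ p != 0 by rewrite gt_eqF// powR_gt0.
set X := D `^ lambda in X0 *; set P := D `^ p in P0 *.
set C2 := `|c| `^ (p - 2); set U2 := `|U| `^ (p - 2).
(* With the powers of D abstracted, eliminating lambda leaves an identity of rational
   expressions. *)
have L : lambda = c * p - p + 1 by rewrite cp; lra.
rewrite L.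
move: (enorm g `^ p) (dotrV nu g) => G s.
field.
by rewrite X0 P0 Dn0.
Qed.

(** * Almost everywhere regularity of the boundary distance *)

Section regular_points.
Context {R : realType} {n : nat}.
Variable Omega : set 'rV[R]_n.
Hypotheses (domO : domain Omega) (OT : Omega <> setT).
Local Notation d := (bdist Omega).
Local Notation bd0 := (boundary_nonempty domO OT).
Local Notation bdc := (closed_boundary domO).

(** Stated for the convex function, whose derivability holds almost everywhere; inside Omega it
    yields the partial derivatives of the distance and the unit length of its gradient. *)
Definition regular_point (x : 'rV[R]_n) :=
  forall i, derivable (dist_conj (boundary Omega)) x (delta_mx 0 i).

Lemma ae_regular_point : \forall x \ae lebesgue_rV n, regular_point x.
Proof.
apply: filter_forall => i.
exists [set x | ~ derivable (dist_conj (boundary Omega)) x (delta_mx 0 i)].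
split => //; last exact: (dist_conj_derivable_ae bd0 bdc).
apply: measurableC; apply: measurable_derivable.
exact: (continuous_dist_conj bd0).
Qed.

Lemma is_derive_bdist x i : Omega x -> regular_point x ->
  is_derive x (delta_mx 0 i) d (partial i d x).
Proof.
move=> Ox rx; have [y By dxy] := dist_set_nearest bd0 bdc x.
have [dd _] := is_derive_dist_set bd0 (bdist_gt0 domO OT Ox) By dxy (rx i).
exact: derivableP.
Qed.

Lemma enorm_grad_bdist x : Omega x -> regular_point x -> enorm (grad d x) = 1.
Proof.
move=> Ox; exact: (enorm_grad_dist_set bd0 bdc (bdist_gt0 domO OT Ox)).
Qed.

Lemma is_derive_bdist_powR (b : R) x i : Omega x -> regular_point x ->
  is_derive x (delta_mx 0 i) (fun z => d z `^ b)
    (b * d x `^ (b - 1) * partial i d x).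
Proof.
move=> Ox rx.
exact: (is_derive_compR (is_derive_bdist i Ox rx)
  (is_derive1_powR b (bdist_gt0 domO OT Ox))).
Qed.

Lemma continuous_bdist_powR (b : R) x : Omega x ->
  {for x, continuous (fun z => d z `^ b)}.
Proof.
move=> Ox; apply: (@continuous_comp _ _ _ d (@powR R ^~ b)).
  exact: (continuous_dist_set bd0).
exact: continuous_powR_pos (bdist_gt0 domO OT Ox).
Qed.

End regular_points.

(** * Gradients and integrability of the terms of the identity *)

Section hardy_identity.
Context {R : realType} {n : nat}.
Variables (Omega : set 'rV[R]_n) (u : 'rV[R]_n -> R).
Hypotheses (domO : domain Omega) (OT : Omega <> setT) (hu : test_fun Omega u).
Local Notation d := (bdist Omega).
Local Notation mu := (lebesgue_rV n).
Local Notation K := (closure [set x | u x != 0]).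

Let bd0 := boundary_nonempty domO OT.

Let cu : continuous u. Proof. exact: Ck_continuous (hu.1 0%N). Qed.

Let Du x i : is_derive x (delta_mx 0 i) u (partial i u x).
Proof. exact: Ck_is_derive (hu.1 1%N). Qed.

Let cdu i : continuous (partial i u).
Proof. by apply: (@Ck_continuous _ _ 0); apply: Ck_partial; exact: hu.1. Qed.

Let mO : measurable Omega.
Proof. by have [oO _ _] := domO; exact: open_measurable_rV. Qed.

Let du0 x i : ~ K x -> partial i u x = 0.
Proof.
move=> Kx.
by have [_] := @is_derive_off_support _ _ u u x i Kx (fun z uz => uz).
Qed.

Lemma grad_bdist_powRM (b : R) x : Omega x -> regular_point Omega x ->
  grad (fun y => d y `^ b * u y) x =
  d x `^ b *: grad u x + (u x * (b * d x `^ (b - 1))) *: grad d x.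
Proof.
move=> Ox rx; apply/rowP => i; rewrite !mxE.
have D := is_derive_bdist_powR domO OT b i Ox rx.
have [_] := is_deriveM D (Du x i); rewrite /partial => ->.
by rewrite -!mulrA.
Qed.

Lemma grad_normr_powRM (p a : R) x : 1 < p -> Omega x ->
  regular_point Omega x ->
  grad (fun y => `|u y| `^ p * d y `^ a) x =
  (`|u x| `^ p * (a * d x `^ (a - 1))) *: grad d x +
  (d x `^ a * (p * (`|u x| `^ (p - 2) * u x))) *: grad u x.
Proof.
move=> p1 Ox rx; apply/rowP => i; rewrite !mxE.
have D := is_derive_bdist_powR domO OT a i Ox rx.
have D2 := is_derive_compR (Du x i) (is_derive_normr_powR (u x) p1).
have [_] := is_deriveM D2 D; rewrite /partial => ->.
by rewrite -!mulrA.
Qed.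

Lemma continuous_normr_powR (p : R) : 1 < p ->
  continuous (fun x => `|u x| `^ p).
Proof.
move=> p1 x; apply: (@continuous_comp _ _ _ u (fun s : R => `|s| `^ p)).
  exact: cu.
have [D _] := is_derive_normr_powR (u x) p1.
exact/differentiable_continuous/derivable1_diffP.
Qed.

Lemma continuous_bdist_powRM (b : R) : continuous (fun y => d y `^ b * u y).
Proof.
apply: (continuous_off_support hu.2); last by move=> z ->; rewrite mulr0.
move=> x Ox; apply: cvgM; last exact: cu.
exact: continuous_bdist_powR.
Qed.

Lemma continuous_normr_powRM (p a : R) : 1 < p ->
  continuous (fun y => `|u y| `^ p * d y `^ a).
Proof.
move=> p1; apply: (continuous_off_support hu.2); last first.
  by move=> z ->; rewrite normr0 powR0 ?mul0r// gt_eqF// (lt_trans ltr01).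
move=> x Ox; apply: cvgM; first exact: continuous_normr_powR.
exact: continuous_bdist_powR.
Qed.

Let m_d : measurable_fun Omega d.
Proof.
apply: measurable_funTS; apply: continuous_measurable_rV.
exact: continuous_dist_set bd0.
Qed.

Let m_grad (f : 'rV[R]_n -> R) i : continuous f ->
  measurable_fun Omega (fun x => grad f x 0 i).
Proof.
move=> cf; apply: measurable_funTS; under eq_fun do rewrite mxE.
exact: measurable_partial.
Qed.

(** The majorant h, continuous in Omega, is bounded on the compact support of u, off which f
    vanishes. *)
Let integrable_supp (f : 'rV[R]_n -> R) (h : 'rV[R]_n -> R) :
  measurable_fun Omega f ->
  (forall x, Omega x -> {for x, continuous h}) ->
  (forall x, Omega x -> `|f x| <= `|h x|) ->
  (forall x, ~ K x -> f x = 0) ->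
  mu.-integrable Omega (EFin \o f).
Proof.
move=> mf ch fh f0; have [cK KO] := hu.2.
have [M HM] := @compact_continuous_bounded _ _ K h cK (fun x Kx => ch x (KO x Kx)).
apply: (@integrable_compact_support _ _ Omega K f `|M|) => // x Ox.
  have [Kx|Kx] := pselect (K x).
    by rewrite (le_trans (fh _ Ox))// (le_trans (HM _ Kx))// ler_norm.
  by rewrite f0// normr0.
by move=> Kx; exact: f0.
Qed.

Lemma integrable_grad_powR (p b : R) : 1 < p ->
  mu.-integrable Omega (EFin \o (fun x => enorm (grad u x) `^ p / d x `^ b)).
Proof.
move=> p1; have p0 : 0 < p := lt_trans ltr01 p1.
pose s x := \sum_i partial i u x * partial i u x.
have s0 x : 0 <= s x by apply: sumr_ge0 => i _; rewrite -expr2 sqr_ge0.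
(* Since |grad u| <= 1 + |grad u|^2, this is a majorant, and its base stays positive, so that the
   power is continuous. *)
apply: (@integrable_supp _ (fun x => (1 + s x) `^ p * d x `^ (- b))).
- under eq_fun do rewrite -powRN.
  apply: measurable_funM; last exact: measurable_fun_powRl.
  apply: measurable_fun_powRl; apply: measurable_fun_enorm => i.
  exact: m_grad.
- move=> x Ox; apply: cvgM; last exact: continuous_bdist_powR.
  apply: (@continuous_comp _ _ _ (fun z => 1 + s z) (@powR R ^~ p)).
    apply: cvgD; first exact: cvg_cst.
    by apply: continuous_rV_sum => i z; apply: cvgM; exact: cdu.
  by apply: continuous_powR_pos; rewrite ltr_wpDr.
- move=> x Ox; rewrite -powRN !ger0_norm ?mulr_ge0 ?powR_ge0//.
  rewrite ler_wpM2r ?powR_ge0//; apply: ge0_ler_powR;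
    rewrite ?nnegrE ?enorm_ge0//.
  + exact: ltW.
  + exact: addr_ge0.
  + have -> : s x = enorm (grad u x) ^+ 2.
      by rewrite sqr_enorm; apply: eq_bigr => i _; rewrite !mxE.
    by have := sqr_ge0 (enorm (grad u x) - 1); have := enorm_ge0 (grad u x);
      nra.
- move=> x Kx; rewrite (_ : grad u x = 0); last first.
    by apply/rowP => i; rewrite !mxE du0.
  rewrite (_ : enorm 0 = 0); last by apply/eqP; rewrite enorm_eq0.
  by rewrite powR0 ?mul0r// gt_eqF.
Qed.

Lemma integrable_normr_powR (p b : R) : 1 < p ->
  mu.-integrable Omega (EFin \o (fun x => `|u x| `^ p / d x `^ b)).
Proof.
move=> p1; have p0 : 0 < p := lt_trans ltr01 p1.
apply: (@integrable_supp _ (fun x => `|u x| `^ p * d x `^ (- b))).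
- under eq_fun do rewrite -powRN.
  apply: measurable_funM; last exact: measurable_fun_powRl.
  by apply: measurable_funTS; apply: continuous_measurable_rV;
    exact: continuous_normr_powR.
- move=> x Ox; apply: cvgM; last exact: continuous_bdist_powR.
  exact: continuous_normr_powR.
- by move=> x Ox; rewrite powRN.
- by move=> x Kx; rewrite support_eq0// normr0 powR0 ?mul0r// gt_eqF.
Qed.

Lemma measurable_grad_pairing (p a : R) : 1 < p -> measurable_fun Omega
  (fun x => dotrV (grad d x) (grad (fun y => `|u y| `^ p * d y `^ a) x)).
Proof.
move=> p1; apply: measurable_fun_dotrV => i; apply: m_grad.
  exact: continuous_dist_set bd0.
exact: continuous_normr_powRM.
Qed.

Lemma integrable_of_ae (f g : 'rV[R]_n -> R) : measurable_fun Omega f ->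
  mu.-integrable Omega (EFin \o g) ->
  (\forall x \ae mu, Omega x -> f x = g x) -> mu.-integrable Omega (EFin \o f).
Proof.
move=> mf /integrableP[mg ig] fg; apply/integrableP; split.
  exact/measurable_EFinP.
rewrite (@ae_eq_integral _ _ _ mu Omega (fun x => `|(EFin \o g) x|%E))//.
- by apply: measurableT_comp => //; exact/measurable_EFinP.
- exact: measurableT_comp.
- by apply: filterS fg => x fgx Ox /=; rewrite fgx.
Qed.

Lemma integrable_grad_pairing (p a : R) : 1 < p -> mu.-integrable Omega (EFin \o
  (fun x => dotrV (grad d x) (grad (fun y => `|u y| `^ p * d y `^ a) x))).
Proof.
move=> p1; have p0 : 0 < p := lt_trans ltr01 p1.
pose A x := `|u x| `^ p * (a * d x `^ (a - 1)).
pose B x := d x `^ a * (p * (`|u x| `^ (p - 2) * u x)).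
pose g x := dotrV (grad d x) (A x *: grad d x + B x *: grad u x).
have mu_ : measurable_fun Omega u.
  by apply: measurable_funTS; exact: continuous_measurable_rV.
have mup b : measurable_fun Omega (fun x => `|u x| `^ b).
  by apply: measurable_fun_powRl; exact: measurableT_comp.
have mA : measurable_fun Omega A.
  apply: measurable_funM => //; apply: measurable_funM;
    first exact: measurable_cst.
  exact: measurable_fun_powRl.
have mB : measurable_fun Omega B.
  apply: measurable_funM; first exact: measurable_fun_powRl.
  by apply: measurable_funM; [exact: measurable_cst|exact: measurable_funM].
apply: (@integrable_of_ae _ g).
- exact: measurable_grad_pairing.
(* The partial derivatives of d are replaced by the bound 1, and |u|^(p-1) by 1 + |u|^p, so that S
   is continuous in Omega. *)
- pose S x := \sum_(i < n) (`|u x| `^ p * (`|a| * d x `^ (a - 1)) +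
     d x `^ a * (p * (1 + `|u x| `^ p)) * `|partial i u x|).
  apply: (@integrable_supp _ S).
  + apply: measurable_fun_dotrV => i.
      by apply: m_grad; exact: continuous_dist_set bd0.
    under eq_fun do rewrite mxE mxE [X in _ + X]mxE.
    apply: measurable_funD; apply: measurable_funM => //; apply: m_grad => //.
    exact: continuous_dist_set bd0.
  + move=> x Ox; apply: continuous_at_rV_sum => i; apply: cvgD.
      apply: cvgM; first exact: continuous_normr_powR.
      by apply: cvgM; [exact: cvg_cst|exact: continuous_bdist_powR].
    apply: cvgM; last by apply: cvg_norm; exact: cdu.
    apply: cvgM; first exact: continuous_bdist_powR.
    apply: cvgM; first exact: cvg_cst.
    by apply: cvgD; [exact: cvg_cst|exact: continuous_normr_powR].
  + move=> x Ox; have Up : `| `|u x| `^ (p - 2) * u x| <= 1 + `|u x| `^ p.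
      rewrite normrM (ger0_norm (powR_ge0 _ _)) mulrC.
      have -> : p - 2 = (p - 1) - 1 by lra.
      rewrite mulr_powRB1 ?subr_gt0//.
      have [u1|u1] := leP `|u x| 1.
        apply: (@le_trans _ _ 1); last by rewrite lerDl powR_ge0.
        apply: (@le_trans _ _ (1 `^ (p - 1))); last by rewrite powR1.
        apply: ge0_ler_powR; rewrite ?nnegrE//.
        by rewrite subr_ge0 ltW.
      rewrite (@le_trans _ _ (`|u x| `^ p))//; last by rewrite lerDr.
      by apply: ler_powR; [exact: ltW|lra].
    rewrite [X in _ <= X]ger0_norm; last first.
      by apply: sumr_ge0 => i _;
        rewrite addr_ge0 ?mulr_ge0 ?powR_ge0 ?addr_ge0 ?powR_ge0// ltW.
    rewrite /g /dotrV (le_trans (ler_norm_sum _ _ _))//; apply: ler_sum => i _.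
    rewrite normrM [X in `|X| * _]mxE -[X in _ <= X]mul1r; apply: ler_pM => //.
      exact: partial_dist_set_le1.
    rewrite !mxE (le_trans (ler_normD _ _))//; apply: lerD.
      rewrite normrM -[X in _ <= X]mulr1; apply: ler_pM => //.
        by rewrite /A !normrM !(ger0_norm (powR_ge0 _ _)).
      exact: partial_dist_set_le1.
    rewrite normrM ler_wpM2r// /B !normrM (ger0_norm (powR_ge0 (d x) _)).
    by rewrite ler_wpM2l ?powR_ge0// gtr0_norm// ler_wpM2l ?(ltW p0)// -normrM.
  + move=> x Kx; rewrite /g /dotrV big1// => i _.
    rewrite !mxE du0// mulr0 addr0 /A (support_eq0 Kx) normr0 powR0 ?gt_eqF//.
    by rewrite !mul0r mulr0.
- apply: filterS (ae_regular_point domO OT) => x rx Ox.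
  by rewrite grad_normr_powRM.
Qed.

End hardy_identity.

(** * From smooth test functions to the Lipschitz function psi *)

Section laplacian_sign.
Context {R : realType} {n : nat}.
Variables (Omega : set 'rV[R]_n) (u : 'rV[R]_n -> R).
Hypotheses (domO : domain Omega) (OT : Omega <> setT) (hu : test_fun Omega u).
Variables (p a : R).
Hypothesis p1 : 1 < p.
Local Notation d := (bdist Omega).
Local Notation hc := (dist_conj (boundary Omega)).
Local Notation mu := (lebesgue_rV n).
Local Notation K := (closure [set x | u x != 0]).
Local Notation psi := (fun x => `|u x| `^ p * d x `^ a).
Variable y : nat -> 'rV[R]_n.
Hypothesis yhc : forall x j, half_sq_affine (y j) x <= hc x.
Hypothesis yhc_sup : forall x (e : R), 0 < e ->
  exists j, hc x - e < half_sq_affine (y j) x.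

Let p0 : 0 < p. Proof. exact: lt_trans ltr01 p1. Qed.
Let bd0 := boundary_nonempty domO OT.
Let cu : continuous u. Proof. exact: Ck_continuous (hu.1 0%N). Qed.
Let Du x i : is_derive x (delta_mx 0 i) u (partial i u x).
Proof. exact: Ck_is_derive (hu.1 1%N). Qed.
Let cdu i : continuous (partial i u).
Proof. by apply: (@Ck_continuous _ _ 0); apply: Ck_partial; exact: hu.1. Qed.
Let mO : measurable Omega.
Proof. by have [oO _ _] := domO; exact: open_measurable_rV. Qed.

Let eps01 k : 0 < (k.+1%:R^-1 : R) <= 1.
Proof. by rewrite invr_gt0 ltr0n/= invf_le1// ler1n. Qed.

Let eps_gt0 k : 0 < k.+1%:R^-1 :> R.
Proof. by have /andP[] := eps01 k. Qed.

(** Approximates d^2 = |x|^2 - 2 [dist_conj] from above. The added 1/(k+1) keeps it positive on the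
    whole space, so all its powers are smooth. *)
Definition smooth_dist2 k x : R := dotrV x x - 2 * lse y k x + k.+1%:R^-1.
Local Notation Q := smooth_dist2.

Let half : R := 2^-1 ^+ 1.

(** A lower bound uniform in k, from the term j = 0 of weight 1/2; as the logarithm is negative, its
    factor 1/(k+1) can be replaced by 1. *)
Let lse_bnd k x : half_sq_affine (y 0) x + ln half <= lse y k x.
Proof.
have := lse_ge y x (leq0n k); apply: le_trans; rewrite lerD2l.
have l0 : ln half <= 0 by apply: ln_le0; rewrite /half expr1 invf_le1// ler1n.
have /andP[_ e1] := eps01 k.
by rewrite -/half -subr_ge0 -{2}(mul1r (ln half)) -mulrBl mulr_le0// subr_le0.
Qed.

Let Q_ge k x : d x ^+ 2 <= Q k x.
Proof.
have := lse_le k (yhc x); rewrite /dist_conj -/(bdist Omega) /Q.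
set e := k.+1%:R^-1; have e0 : 0 < e := eps_gt0 k; lra.
Qed.

Let dist2_bound x : R :=
  dotrV x x - 2 * (half_sq_affine (y 0) x + ln half) + 1.

Let Q_le k x : Q k x <= dist2_bound x.
Proof.
rewrite /Q /dist2_bound; have := lse_bnd k x.
set e := k.+1%:R^-1; have /andP[_ e1] : 0 < e <= 1 := eps01 k; lra.
Qed.

Let Q_gt0 k x : 0 < Q k x.
Proof.
have := lse_le k (yhc x); rewrite /dist_conj -/(bdist Omega) /Q.
have := sqr_ge0 (d x).
set e := k.+1%:R^-1; have e0 : 0 < e := eps_gt0 k; lra.
Qed.

Definition smooth_psi k x : R :=
  reg_powR p k.+1%:R^-1 (u x) * Q k x `^ (a / 2).

Let Ck_Q m k : Ck m (Q k).
Proof.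
apply: CkD; last exact: Ck_cst.
apply: CkD; first exact: Ck_dotrVV.
rewrite (_ : (fun x => _) = fun x => - 2 * lse y k x); last first.
  by apply/funext => x; rewrite mulNr.
by apply: CkM; [exact: Ck_cst|exact: Ck_lse].
Qed.

Let psi_eq0 k x : u x = 0 -> smooth_psi k x = 0.
Proof. by rewrite /smooth_psi /reg_powR => ->; rewrite !mul0r. Qed.

(** Both bases are positive everywhere, which gives smoothness, and the factor [reg_powR] vanishes
    with u, which confines the support to that of u. *)
Lemma test_fun_smooth_psi k : test_fun Omega (smooth_psi k).
Proof.
have [Cu [cK KO]] := hu; split => [m|].
  apply: CkM; last exact: Ck_powR (Q_gt0 k) (Ck_Q m k).
  apply: CkM; first by apply: CkM; exact: Cu.
  apply: Ck_powR.
    by move=> x; rewrite ltr_wpDl// -expr2 sqr_ge0.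
  by apply: CkD; [apply: CkM; exact: Cu|exact: Ck_cst].
have sK : closure [set x | smooth_psi k x != 0] `<=` K.
  apply: closureS => x /=; apply: contra_neq; exact: psi_eq0.
split; last exact: subset_trans sK KO.
by apply: subclosed_compact sK => //; exact: closed_closure.
Qed.

Lemma smooth_psi_ge0 k x : 0 <= smooth_psi k x.
Proof. by rewrite mulr_ge0 ?powR_ge0// reg_powR_ge0. Qed.

Lemma partial_smooth_psi k x i : partial i (smooth_psi k) x =
  reg_powR' p k.+1%:R^-1 (u x) * partial i u x * Q k x `^ (a / 2) +
  reg_powR p k.+1%:R^-1 (u x) * (a / 2 * Q k x `^ (a / 2 - 1) *
    (2 * x 0 i - 2 * partial i (lse y k) x)).
Proof.
have D1 := is_derive_compR (Du x i) (is_derive_reg_powR p (u x) (eps_gt0 k)).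
have Dl := Ck_is_derive x i (Ck_lse y 1 k).
have DQ : is_derive x (delta_mx 0 i) (Q k) (2 * x 0 i - 2 * partial i (lse y k) x).
  have Dx := is_derive_dotrVV x i.
  have D2 : is_derive x (delta_mx 0 i) (fun z => dotrV z z - 2 * lse y k z)
      (2 * x 0 i - 2 * partial i (lse y k) x).
    exact: is_deriveB.
  apply: is_derive_eq (is_deriveD D2 (is_derive_cst (k.+1%:R^-1 : R) x _)) _.
  by rewrite addr0.
have D2 := is_derive_compR DQ (is_derive1_powR (a / 2) (Q_gt0 k x)).
have [_] := is_deriveM D1 D2; rewrite /partial => ->.
by rewrite /= addrC [X in X + _]mulrC.
Qed.

(** By convexity the slope at x is controlled by the increments over unit steps in both directions,
    bounded above through [hc] and below through [lse_bnd], uniformly in k. *)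
Let lse_slope i x : R := `|hc (1 *: delta_mx 0 i + x)| +
  `|hc (-1 *: delta_mx 0 i + x)| + `|half_sq_affine (y 0) x| + `|ln half|.

Let partial_lse_le k i x : `|partial i (lse y k) x| <= lse_slope i x.
Proof.
have := lse_subgradient y k x i 1; have := lse_subgradient y k x i (-1).
have := lse_le k (yhc (1 *: delta_mx 0 i + x)).
have := lse_le k (yhc (-1 *: delta_mx 0 i + x)).
have := lse_bnd k x; rewrite /lse_slope.
have := ler_norm (hc (1 *: delta_mx 0 i + x)).
have := ler_norm (hc (-1 *: delta_mx 0 i + x)).
have := ler_norm (- half_sq_affine (y 0) x); have := ler_norm (- ln half).
have := normr_ge0 (hc (1 *: delta_mx 0 i + x)).
have := normr_ge0 (hc (-1 *: delta_mx 0 i + x)).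
rewrite !normrN ler_norml => *; apply/andP; split; lra.
Qed.

Let pow_bound b x : R := (d x ^+ 2) `^ b + dist2_bound x `^ b.

Let Q_powR_le k b x : Omega x -> Q k x `^ b <= pow_bound b x.
Proof.
move=> Ox; apply: powR_le_endpoints => //;
  first exact: exprn_gt0 (bdist_gt0 domO OT Ox).
Qed.

(** A majorant independent of k and continuous in Omega, hence bounded on the support of u; it makes
    dominated convergence possible. *)
Let partial_bound i x : R :=
  (2 + `|p - 2|) * (u x * u x + 1) `^ ((p - 1) / 2) * `|partial i u x| *
    pow_bound (a / 2) x +
  (u x * u x + 1) `^ (p / 2) *
    (`|a / 2| * pow_bound (a / 2 - 1) x * (2 * `|x 0 i| + 2 * lse_slope i x)).

Let partial_smooth_psi_le k x i : Omega x ->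
  `|partial i (smooth_psi k) x| <= partial_bound i x.
Proof.
move=> Ox; rewrite partial_smooth_psi (le_trans (ler_normD _ _))//.
apply: lerD.
  rewrite !normrM (ger0_norm (powR_ge0 _ _)).
  apply: ler_pM; rewrite ?mulr_ge0 ?powR_ge0//; last exact: Q_powR_le.
  by apply: ler_pM => //; exact: reg_powR'_le.
rewrite normrM; apply: ler_pM => //.
  by rewrite ger0_norm ?reg_powR_ge0//; exact: reg_powR_le.
rewrite normrM; apply: ler_pM => //.
  rewrite normrM (ger0_norm (powR_ge0 _ _)).
  by apply: ler_pM; rewrite ?powR_ge0//; exact: Q_powR_le.
rewrite (le_trans (ler_normB _ _))// !normrM ger0_norm//.
by apply: lerD => //; rewrite ler_wpM2l.
Qed.

Let partial_bound_continuous i x : Omega x ->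
  {for x, continuous (partial_bound i)}.
Proof.
move=> Ox.
have d0 := bdist_gt0 domO OT Ox.
have chc : continuous hc := continuous_dist_conj bd0.
have chcB (v : 'rV[R]_n) : continuous (fun z => `|hc (v + z)|).
  move=> z; apply: cvg_norm.
  apply: (@continuous_comp _ _ _ (fun z : 'rV[R]_n => v + z) hc);
    last exact: chc.
  by apply: cvgD; [exact: cvg_cst|exact: cvg_id].
have c0 : continuous (half_sq_affine (y 0)) :=
  Ck_continuous (Ck_half_sq_affine 0 (y 0)).
have cuu b : {for x, continuous (fun z => (u z * u z + 1) `^ b)}.
  apply: (@continuous_comp _ _ _ (fun z => u z * u z + 1) (@powR R ^~ b)).
    apply: cvgD; last exact: cvg_cst.
    by apply: cvgM; exact: cu.
  by apply: continuous_powR_pos; rewrite ltr_wpDl// -expr2 sqr_ge0.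
have cpow b : {for x, continuous (pow_bound b)}.
  apply: cvgD.
    apply: (@continuous_comp _ _ _ (fun z => d z ^+ 2) (@powR R ^~ b)).
      apply: (@continuous_comp _ _ _ d (fun t : R => t ^+ 2)).
        exact: (continuous_dist_set bd0).
      exact: exprn_continuous.
    by apply: continuous_powR_pos; rewrite exprn_gt0.
  apply: (@continuous_comp _ _ _ dist2_bound (@powR R ^~ b)).
    apply: cvgD; last exact: cvg_cst.
    apply: cvgB; first exact: continuous_dotrVV.
    apply: cvgM; first exact: cvg_cst.
    by apply: cvgD; [exact: c0|exact: cvg_cst].
  apply: continuous_powR_pos; apply: lt_le_trans (Q_le 0 x).
  exact: Q_gt0.
apply: cvgD.
  apply: cvgM; last exact: cpow.
  apply: cvgM; last by apply: cvg_norm; exact: cdu.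
  by apply: cvgM; [exact: cvg_cst|exact: cuu].
apply: cvgM; first exact: cuu.
apply: cvgM.
  by apply: cvgM; [exact: cvg_cst|exact: cpow].
apply: cvgD.
  by apply: cvgM; [exact: cvg_cst|apply: cvg_norm; exact: coord_continuous].
apply: cvgM; first exact: cvg_cst.
apply: cvgD; last exact: cvg_cst.
apply: cvgD; last by apply: cvg_norm; exact: c0.
by apply: cvgD; exact: chcB.
Qed.

Lemma partial_smooth_psi_cvg x i : Omega x -> regular_point Omega x ->
  partial i (smooth_psi k) x @[k --> \oo] --> partial i psi x.
Proof.
move=> Ox rx.
have d0 := bdist_gt0 domO OT Ox.
have clse z : lse y k z @[k --> \oo] --> hc z.
  exact: lse_cvg (yhc z) (yhc_sup z).
have cQ : Q k x @[k --> \oo] --> d x ^+ 2.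
  have -> : d x ^+ 2 = dotrV x x - 2 * hc x + 0 by rewrite /dist_conj -/(bdist Omega); lra.
  apply: cvgD; last exact: cvg_harmonic.
  apply: cvgB; first exact: cvg_cst.
  by apply: cvgM; [exact: cvg_cst|exact: clse].
have cQp b : Q k x `^ b @[k --> \oo] --> d x `^ (2 * b).
  rewrite powRrM powR_mulrn ?(ltW d0)//.
  apply: (continuous_cvg _ (continuous_powR_pos (a := b) _) cQ).
  by rewrite exprn_gt0.
have cpl : partial i (lse y k) x @[k --> \oo] --> partial i hc x.
  have /derivableP/is_derive_line [dg] := rx i; rewrite /partial => <-.
  apply: (subgradient_cvg (gk := fun k t => lse y k (t *: delta_mx 0 i + x))
    (g := fun t => hc (t *: delta_mx 0 i + x))) => // k r.
  by rewrite scale0r add0r; exact: lse_subgradient.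
(* Both sides equal 2 (x_i - z_i) for a nearest boundary point z. *)
have pd : 2 * x 0 i - 2 * partial i hc x = 2 * d x * partial i d x.
  have [z Bz dxz] := dist_set_nearest bd0 (closed_boundary domO) x.
  rewrite (partial_dist_conj bd0 Bz dxz (rx i)).
  have [_] := is_derive_dist_set bd0 d0 Bz dxz (rx i).
  rewrite /partial => ->; rewrite !mxE.
  by field; rewrite gt_eqF.
have -> : partial i psi x =
    p * (`|u x| `^ (p - 2) * u x) * partial i u x * d x `^ (2 * (a / 2)) +
    `|u x| `^ p * (a / 2 * d x `^ (2 * (a / 2 - 1)) *
      (2 * x 0 i - 2 * partial i hc x)).
  have /rowP/(_ i) := grad_normr_powRM domO OT hu a p1 Ox rx.
  rewrite !mxE => ->; rewrite pd.
  have -> : 2 * (a / 2) = a by field.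
  have -> : 2 * (a / 2 - 1) = (a - 1) - 1 by field.
  rewrite [d x `^ (a - 1 - 1)]powRB ?(gt_eqF d0) ?implybT// (powRr1 (ltW d0)).
  by field; rewrite gt_eqF.
under eq_fun do rewrite partial_smooth_psi.
apply: cvgD.
  apply: cvgM; last exact: cQp.
  by apply: cvgM; [exact: reg_powR'_cvg|exact: cvg_cst].
apply: cvgM; first exact: reg_powR_cvg.
apply: cvgM.
  by apply: cvgM; [exact: cvg_cst|exact: cQp].
apply: cvgB; first exact: cvg_cst.
by apply: cvgM; [exact: cvg_cst|exact: cpl].
Qed.

Lemma lap_bdist_smooth_psi_cvg :
  lap_bdist Omega (smooth_psi k) @[k --> \oo] --> lap_bdist Omega psi.
Proof.
have [cK KO] := hu.2.
have [M HM] : exists M, forall x, K x -> `|\sum_i partial_bound i x| <= M.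
  apply: compact_continuous_bounded => // x Kx.
  by apply: continuous_at_rV_sum => i; apply: partial_bound_continuous;
    exact: KO.
have M0 x : K x -> 0 <= M by move=> /HM; exact: le_trans.
have mK : measurable K by apply: closed_measurable_rV; exact: closed_closure.
pose f k x := dotrV (grad d x) (grad (smooth_psi k) x).
pose f0 x := dotrV (grad d x) (grad psi x).
have mgd i : measurable_fun Omega (fun x => grad d x 0 i).
  apply: measurable_funTS; under eq_fun do rewrite mxE.
  by apply: measurable_partial; exact: continuous_dist_set bd0.
have mf k : measurable_fun Omega (f k).
  apply: measurable_fun_dotrV => // i.
  apply: measurable_funTS; under eq_fun do rewrite mxE.
  by apply: measurable_partial;
    exact: Ck_continuous ((test_fun_smooth_psi k).1 0%N).
have ig : mu.-integrable Omega (EFin \o (fun x => M * \1_K x)).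
  apply: (@integrable_compact_support _ _ Omega K _ `|M|) => //.
  - apply: measurable_funM; first exact: measurable_cst.
    exact: measurable_indic.
  - move=> x _; rewrite indicE normrM.
    by case: (_ \in _); rewrite ?normr1 ?mulr1// normr0 mulr0.
  - by move=> x _ Kx; rewrite indicE memNset// mulr0.
(* The integrands are dominated by M on the support of u, and vanish off it because [smooth_psi] is
   locally zero there. *)
have [] := @dominated_convergence _ _ _ mu Omega mO (fun k => EFin \o f k) (EFin \o f0)
  (EFin \o (fun x => M * \1_K x)).
- by move=> k; exact/measurable_EFinP.
- by apply/measurable_EFinP; exact: (measurable_grad_pairing domO OT hu a p1).
- apply: filterS (ae_regular_point domO OT) => x rx Ox.
  have C : f k x @[k --> \oo] --> f0 x.
    rewrite /f /f0 /dotrV; elim: (index_enum _) => [|i r IHr].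
      by under eq_fun do rewrite big_nil; rewrite big_nil; exact: cvg_cst.
    under eq_fun do rewrite big_cons.
    rewrite big_cons; apply: cvgD => //; apply: cvgM; first exact: cvg_cst.
    under eq_fun do rewrite mxE.
    by rewrite mxE; exact: partial_smooth_psi_cvg.
  by apply: cvg_EFin; [near=> k|exact: C].
- exact: ig.
- apply: aeW => x k Ox; rewrite lee_fin.
  have [Kx|Kx] := pselect (K x).
    rewrite indicE mem_set// mulr1.
    apply: le_trans (HM _ Kx); rewrite /f /dotrV.
    apply: le_trans (ler_norm _); rewrite (le_trans (ler_norm_sum _ _ _))//.
    apply: ler_sum => i _; rewrite normrM !mxE -[X in _ <= X]mul1r.
    apply: ler_pM => //; first exact: partial_dist_set_le1.
    exact: partial_smooth_psi_le.
  rewrite indicE memNset// mulr0 /f /dotrV big1 ?normr0// => i _.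
  rewrite !mxE; have [_] : is_derive x (delta_mx 0 i) (smooth_psi k) 0.
    by apply: (@is_derive_off_support _ _ u) => // z; exact: psi_eq0.
  by rewrite /partial => ->; rewrite mulr0.
move=> if0 _ H; apply: cvgN.
apply: fine_cvg; rewrite fineK; first exact: H.
exact: integrable_fin_num.
Unshelve. all: by end_near. Qed.

End laplacian_sign.

(** The pairing is the limit of pairings with nonnegative test functions, built from a sequence of
    boundary points realizing the distance. *)
Lemma lap_bdist_normr_powRM_ge0 {R : realType} {n : nat} (Omega : set 'rV[R]_n)
    (u : 'rV[R]_n -> R) (p a sigma : R) :
  domain Omega -> Omega <> setT -> test_fun Omega u -> 1 < p ->
  scaled_lap_bdist_ge0 Omega sigma ->
  0 <= sigma * lap_bdist Omega (fun x => `|u x| `^ p * bdist Omega x `^ a).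
Proof.
move=> domO OT hu p1 Hs.
have bd0 := boundary_nonempty domO OT.
have [y [By Hy]] := dist_set_sequence bd0.
have ysup x := half_sq_affine_sup bd0 By (Hy x).
have y1 x := (ysup x).1; have y2 x := (ysup x).2.
have H : (sigma * lap_bdist Omega (smooth_psi u p a y k)) @[k --> \oo] -->
    sigma * lap_bdist Omega (fun x => `|u x| `^ p * bdist Omega x `^ a).
  apply: cvgM; first exact: cvg_cst.
  exact: lap_bdist_smooth_psi_cvg.
rewrite -(cvg_lim _ H)//; apply: limr_ge; first by apply/cvg_ex; eexists;
  exact: H.
near=> k; apply: Hs; first exact: test_fun_smooth_psi.
exact: smooth_psi_ge0.
Unshelve. all: by end_near. Qed.

(** * The weighted Hardy identity and inequality *)

Unset Implicit Arguments.

Theorem corollary3p11 (R : realType) (N : nat) (hN : (2 <= N)%N)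
    (Omega : set 'rV[R]_N) (domOmega : domain Omega) (OmegaT : Omega <> setT)
    (p lambda : R) (p1 : 1 < p) (plambda : p + lambda - 1 != 0)
    (u : 'rV[R]_N -> R) (hu : test_fun Omega u) :
  let mu := lebesgue_rV N in
  let d := bdist Omega in
  let c := (p + lambda - 1) / p in
  let F := fun x => enorm (grad u x) `^ p / d x `^ lambda in
  let G := fun x => `|u x| `^ p / d x `^ (lambda + p) in
  let H := fun x => (d x `^ lambda)^-1 *
    Cp p (grad u x) (d x `^ c *: grad (fun y => d y `^ (- c) * u y) x) in
  let psi := fun x => `|u x| `^ p * d x `^ (1 - p - lambda) in
  let rhs := \int[mu]_(x in Omega) H x
             - c * `|c| `^ (p - 2) * lap_bdist Omega psi in
  [/\ [/\ mu.-integrable Omega (EFin \o F),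
          mu.-integrable Omega (EFin \o G),
          mu.-integrable Omega (EFin \o H) &
          mu.-integrable Omega
            (EFin \o (fun x => dotrV (grad d x) (grad psi x)))],
      \int[mu]_(x in Omega) F x - `|c| `^ p * \int[mu]_(x in Omega) G x = rhs
    & scaled_lap_bdist_ge0 Omega (- (p + lambda - 1)) ->
      0 <= rhs /\
      `|c| `^ p * \int[mu]_(x in Omega) G x <= \int[mu]_(x in Omega) F x].
Proof.
move=> mu d c F G H psi rhs.
have p0 : 0 < p := lt_trans ltr01 p1.
have [oO _ _] := domOmega.
have mO : measurable Omega by exact: open_measurable_rV.
have bd0 := boundary_nonempty domOmega OmegaT.
pose D x := dotrV (grad d x) (grad psi x).
have iF : mu.-integrable Omega (EFin \o F) :=
  integrable_grad_powR domOmega OmegaT hu lambda p1.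
have iG : mu.-integrable Omega (EFin \o G) :=
  integrable_normr_powR domOmega OmegaT hu (lambda + p) p1.
have iD : mu.-integrable Omega (EFin \o D) :=
  integrable_grad_pairing domOmega OmegaT hu (1 - p - lambda) p1.
(* The value of H at regular points, by the pointwise identity. Integrability and the integral are
   computed for H' and carried over to H, whose measurability is proved separately. *)
pose H' x := F x - `|c| `^ p * G x - c * `|c| `^ (p - 2) * D x.
have ZG : mu.-integrable Omega (EFin \o (fun x => `|c| `^ p * G x)).
  exact: (integrableZl mO (`|c| `^ p) iG).
have ZD : mu.-integrable Omega (EFin \o (fun x => c * `|c| `^ (p - 2) * D x)).
  exact: (integrableZl mO (c * `|c| `^ (p - 2)) iD).
have iFG : mu.-integrable Omega (EFin \o (fun x => F x - `|c| `^ p * G x)).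
  exact: (integrableB mO iF ZG).
have iH' : mu.-integrable Omega (EFin \o H').
  exact: (integrableB mO iFG ZD).
have mH : measurable_fun Omega H.
  have md : measurable_fun Omega d.
    apply: measurable_funTS; apply: continuous_measurable_rV.
    exact: continuous_dist_set bd0.
  have mg f : continuous f ->
    forall i, measurable_fun Omega (fun x => grad f x 0 i).
    move=> cf i; apply: measurable_funTS; under eq_fun do rewrite mxE.
    exact: measurable_partial.
  have cu : continuous u := Ck_continuous (hu.1 0%N).
  rewrite /H; under eq_fun do rewrite -powRN.
  apply: measurable_funM; first exact: measurable_fun_powRl.
  apply: measurable_fun_Cp => i; first exact: mg.
  under eq_fun do rewrite mxE.
  apply: measurable_funM; first exact: measurable_fun_powRl.
  by apply: mg; exact: (continuous_bdist_powRM domOmega OmegaT hu).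
have HH' : \forall x \ae mu, Omega x -> H x = H' x.
  apply: filterS (ae_regular_point domOmega OmegaT) => x rx Ox.
  have := hardy_pointwise (grad u x) (u x) lambda (bdist_gt0 domOmega OmegaT Ox)
    (enorm_grad_bdist domOmega OmegaT Ox rx) p1.
  rewrite -(grad_bdist_powRM domOmega OmegaT hu) // -(grad_normr_powRM domOmega OmegaT hu) //.
  rewrite -/c -/d /H' /F /G /D => ->.
  by rewrite addrK.
have iH : mu.-integrable Omega (EFin \o H) by exact: integrable_of_ae mH iH' HH'.
have EH : \int[mu]_(x in Omega) H x = \int[mu]_(x in Omega) H' x.
  rewrite /Rintegral; congr fine; apply: ae_eq_integral => //.
  - exact/measurable_EFinP.
  - by have /integrableP[] := iH'.
  - by apply: filterS HH' => x HHx Ox; rewrite HHx.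
have E : \int[mu]_(x in Omega) F x - `|c| `^ p * \int[mu]_(x in Omega) G x = rhs.
  rewrite /rhs EH /lap_bdist mulrN opprK.
  rewrite RintegralB// RintegralB// RintegralZl// RintegralZl//.
  by rewrite subrK.
split=> // Hs.
have H0 : 0 <= \int[mu]_(x in Omega) H x.
  apply: Rintegral_ge0 => x Ox; rewrite mulr_ge0 ?invr_ge0 ?powR_ge0//.
  exact: Cp_ge0.
have L0 := lap_bdist_normr_powRM_ge0 (1 - p - lambda) domOmega OmegaT hu p1 Hs.
have R0 : 0 <= rhs.
  (* Since c is (p + lambda - 1) / p, the coefficient of the pairing is -(p + lambda - 1) times the
     nonnegative |c|^(p-2) / p, which matches the sign hypothesis. *)
  have -> : rhs = \int[mu]_(x in Omega) H x +
      `|c| `^ (p - 2) / p * (- (p + lambda - 1) * lap_bdist Omega psi).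
    rewrite /rhs; congr (_ + _); rewrite {1}/c.
    by field; rewrite gt_eqF.
  by rewrite addr_ge0// mulr_ge0// divr_ge0 ?powR_ge0// ltW.
split=> //.
by rewrite -subr_ge0 E.
Qed.
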